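(* For $n\ge2$ let $$N_n(w)=\frac{N(0,n)}{2}+\sum_{1\le m<n}N(m,n)w^m,\qquad M_n(w)=\frac{M(0,n)}{2}+\sum_{1\le m\le n}M(m,n)w^m.$$ As $n\to\infty$, the roots of $N_n(w)$ tend to equidistribution on the unit circle, and the roots of $M_n(w)$ tend to equidistribution on the unit circle.
   Context: For a partition $\lambda$, $\operatorname{rank}(\lambda)$ is the largest part of $\lambda$ minus the number of parts of $\lambda$. The crank of $\lambda$ is the largest part of $\lambda$ if $1$ is not a part of $\lambda$, and is $\mu(\lambda)-o(\lambda)$ if $1$ is a part of $\lambda$, where $o(\lambda)$ is the number of $1$s in $\lambda$ and $\mu(\lambda)$ is the number of parts of $\lambda$ strictly larger than $o(\lambda)$. $N(m,n)$ (resp. $M(m,n)$) is the number of partitions of $n$ with rank (resp. crank) $m$. For a polynomial $f$ of degree $d\ge1$ with roots $z_1,\dots,z_d\in\mathbb{C}$ listed with multiplicity, let $\mu_{\{f\}}=\frac1d\sum_{j=1}^d\delta_{z_j}$, where $\delta_z$ is the Dirac measure at $z$. The roots of a sequence of polynomials $f_n$ tend to equidistribution on the unit circle as $n\to\infty$ if $\mu_{\{f_n\}}$ converges weakly, as measures on $\mathbb{C}$, to the normalized Haar (uniform probability) measure on $\{|z|=1\}$. *)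

(* Defs.v *)
From HB Require Import structures.
From mathcomp Require Import all_boot all_order all_algebra.
From mathcomp Require Import all_classical all_reals all_analysis.
From mathcomp Require Import measurable_realfun complex.

Set Implicit Arguments.
Unset Strict Implicit.
Unset Printing Implicit Defensive.

Import Order.TTheory GRing.Theory Num.Theory.
Import numFieldNormedType.Exports.

Local Open Scope classical_set_scope.
Local Open Scope ring_scope.

(* Integer partitions of n are weakly decreasing sequences of positive
   integers with sum n. *)
Definition is_intpart (n : nat) (s : seq nat) : bool :=
  [&& sorted geq s, 0%N \notin s & sumn s == n].

Record intpart (n : nat) :=
  IntPart { parts :> seq nat; intpartP : is_intpart n parts }.

HB.instance Definition _ n := [isSub for @parts n].
HB.instance Definition _ n := [Countable of intpart n by <:].

Lemma intpart_bounded n (p : intpart n) :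
  (size p <= n)%N /\ {in parts p, forall i, (i <= n)%N}.
Proof.
case: p => s /= /and3P[_ s0 /eqP <-]; split.
  elim: s s0 => //= -[|i] s IHs; rewrite inE negb_or //= => /IHs le_s.
  by rewrite -[(size s).+1]add1n leq_add.
by elim: {s0}s => //= j s IHs i; rewrite inE => /predU1P[->|/IHs /leq_trans];
  [exact: leq_addr | apply; exact: leq_addl].
Qed.

Definition intpart_enum n : seq (intpart n) :=
  undup (pmap insub
    [seq map val t | k : nat <- iota 0 n.+1,
       t : k.-tuple 'I_n.+1 <- enum {: k.-tuple 'I_n.+1}]).

Lemma intpart_enumP n : Finite.axiom (intpart_enum n).
Proof.
apply: Finite.uniq_enumP; first exact: undup_uniq.
move=> p; rewrite inE mem_undup mem_pmap; apply/mapP.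
have [sz_p le_p] := intpart_bounded p.
exists (parts p); last by rewrite valK.
apply/allpairsPdep; exists (size p), (map_tuple inord (in_tuple p)).
split; first by rewrite mem_iota.
- by rewrite mem_enum.
- rewrite /= -map_comp -[LHS]map_id; apply/eq_in_map => i /le_p le_in.
  by rewrite /= inordK.
Qed.

HB.instance Definition _ n := fintype.isFinite.Build (intpart n) (@intpart_enumP n).

Definition largest_part (s : seq nat) : nat := (\max_(i <- s) i)%N.

Definition part_rank (s : seq nat) : int :=
  (largest_part s)%:Z - (size s)%:Z.

Definition part_crank (s : seq nat) : int :=
  let o := count_mem 1%N s in
  let mu := count (fun i => o < i)%N s in
  if 1%N \in s then mu%:Z - o%:Z else (largest_part s)%:Z.

Definition num_rank (m : int) (n : nat) : nat :=
  #|[set p : intpart n | part_rank p == m]%SET|.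

Definition num_crank (m : int) (n : nat) : nat :=
  #|[set p : intpart n | part_crank p == m]%SET|.

Definition rank_poly (R : realType) (n : nat) : {poly R[i]} :=
  ((num_rank 0 n)%:R / 2)%:P +
  \sum_(1 <= m < n) (num_rank m%:Z n)%:R *: 'X^m.

Definition crank_poly (R : realType) (n : nat) : {poly R[i]} :=
  ((num_crank 0 n)%:R / 2)%:P +
  \sum_(1 <= m < n.+1) (num_crank m%:Z n)%:R *: 'X^m.

(* The topology on R[i] is that of its modulus; [R[i]^o] carries it for any
   numFieldType, and it is transferred here to R[i] itself. *)
HB.instance Definition _ (R : rcfType) := NormedModule.copy R[i] R[i]^o.

Definition borelC (R : realType) := g_sigma_algebraType (@open R[i]).

Definition weak_cvg (R : realType) (m_ : {measure set (borelC R) -> \bar R}^nat)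
    (m : {measure set (borelC R) -> \bar R}) : Prop :=
  forall f : R[i] -> R, continuous f -> bounded_fun f ->
  (\int[m_ n]_z (f z)%:E @[n --> \oo] --> \int[m]_z (f z)%:E)%E.

(* For f != 0, the roots of f with multiplicity; in particular this sequence
   then has length (size f).-1, the degree of f. *)
Definition croots (R : realType) (f : {poly R[i]}) : seq R[i] :=
  sval (closed_field_poly_normal f).

(* If f is constant then d = 0 and this is the zero measure. *)
Definition root_measure (R : realType) (f : {poly R[i]}) :
    {measure set (borelC R) -> \bar R} :=
  let d := (size f).-1 in
  mscale (d%:R^-1)%:nng (msum (fun j => \d_((croots f)`_j : borelC R)) d).

Definition expi2pi (R : realType) (t : measurableTypeR R) : borelC R :=
  Complex (cos (2 * pi * t)) (sin (2 * pi * t)).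

Lemma continuous_expi2pi (R : realType) :
  continuous (@expi2pi R : R -> R[i]).
Proof.
have cC (g : R -> R) : continuous g -> continuous (fun t => (g t)%:C%C : R[i]).
  move=> cg t; apply/cvgrPdist_lt => -[e e'] /=.
  rewrite ltcE /= => /andP[/eqP -> e0].
  have /cvgrPdist_lt /(_ _ e0) := cg t.
  apply: filterS => u gu.
  by rewrite -rmorphB /= normc_def /= expr0n addr0 sqrtr_sqr ltcR.
have c2pi : continuous (fun t : R => 2 * pi * t) by exact: mulrl_continuous.
have ccos : continuous (fun t : R => cos (2 * pi * t)).
  by move=> t; apply: continuous_comp; [exact: c2pi | exact: continuous_cos].
have csin : continuous (fun t : R => sin (2 * pi * t)).
  by move=> t; apply: continuous_comp; [exact: c2pi | exact: continuous_sin].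
have -> : (@expi2pi R : R -> R[i]) = fun t =>
    ((cos (2 * pi * t))%:C%C + (Complex 0 1) * (sin (2 * pi * t))%:C%C : R[i]).
  by apply/funext => t; rewrite [LHS]complexE.
move=> t; apply: (@cvgD R[i] R[i]^o); first exact: cC.
by apply: cvgMl_tmp; exact: cC.
Qed.

Lemma measurable_expi2pi (R : realType) :
  measurable_fun [set: measurableTypeR R] (@expi2pi R).
Proof.
apply: (@measurability _ _ (measurableTypeR R) (borelC R) _ _ (@open R[i])) => // _ [B oB <-]; rewrite setTI.
apply: open_measurable.
by apply: open_comp oB => t _; exact: continuous_expi2pi.
Qed.

HB.instance Definition _ (R : realType) :=
  isMeasurableFun.Build _ _ _ _ (@expi2pi R) (@measurable_expi2pi R).

(* The normalized Haar measure of the unit circle, as a measure on the complex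
   plane: the law of exp(2 i pi t) for t uniform in [0, 1]. *)
Definition circle_haar (R : realType) : {measure set (borelC R) -> \bar R} :=
  distribution (uniform_prob (@ltr01 R)) (@expi2pi R).

Definition equidistributed_on_circle (R : realType) (f_ : nat -> {poly R[i]}) :
    Prop :=
  weak_cvg (fun n => root_measure (f_ n)) (circle_haar R).

(* Main.v *)
Require Import Defs.
From mathcomp Require Import all_boot all_order all_algebra.
From mathcomp Require Import all_classical all_reals all_analysis.
From mathcomp Require Import measurable_realfun complex.
From mathcomp Require Import ring lra.

(* If [p] has degree [d], modulus at most [L] on the unit circle, and leading and
   constant coefficients bounded below, then moving the roots inside the disk
   outwards by inversion changes [|p|] on the circle by a constant factor only,
   and Cauchy's estimates for the resulting polynomial bound
   [\sum_z |ln |z||] over the roots by [O(ln L)]: most roots are near the circle.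
   The resulting polynomial has no zero in the open disk, so its logarithm is
   harmonic there and bounded above by [O(ln L)]; testing it against the
   nonnegative weights [1 + Re (c w^k)] bounds every power sum of the arguments
   of the roots by [O_k (ln L)].  By Fejer's kernel the roots are then
   equidistributed as soon as [ln L = o(d)].  For the rank and crank polynomials
   [L] is at most the number of partitions of [n], which Euler's product shows to
   be [exp (o(n))], and the extreme coefficients are positive integers (halved
   for the constant one). *)

Set Implicit Arguments.
Unset Strict Implicit.
Unset Printing Implicit Defensive.

Import Order.TTheory GRing.Theory Num.Theory.
Import numFieldNormedType.Exports.
Import ComplexField.Normc.

Local Open Scope classical_set_scope.
Local Open Scope ring_scope.

(** * Complex modulus and roots of unity *)

Lemma normcE (R : rcfType) (z : R[i]) : `|z| = (normc z)%:C%C.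
Proof. by []. Qed.

Lemma normc_ge0 (R : rcfType) (z : R[i]) : 0 <= normc z.
Proof. by rewrite -ler0c -normcE. Qed.

Lemma normc_gt0 (R : rcfType) (z : R[i]) : (0 < normc z) = (z != 0).
Proof. by rewrite -[RHS]normr_gt0 normcE ltcR. Qed.

Lemma ler_normcD (R : rcfType) (x y : R[i]) :
  normc (x + y) <= normc x + normc y.
Proof. by rewrite -lecR rmorphD /= -!normcE ler_normD. Qed.

Lemma normcB (R : rcfType) (x y : R[i]) : normc (x - y) = normc (y - x).
Proof. by apply: complexI; rewrite -!normcE distrC. Qed.

Lemma normcX (R : rcfType) (x : R[i]) n : normc (x ^+ n) = normc x ^+ n.
Proof. by apply: complexI; rewrite rmorphXn /= -!normcE normrX. Qed.

Lemma normc_conj (R : rcfType) (x : R[i]) : normc x^*%C = normc x.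
Proof. by apply: complexI; rewrite -!normcE normcJ. Qed.

Lemma normc_real (R : rcfType) (x : R) : normc x%:C%C = `|x|.
Proof. by rewrite /normc /= expr0n addr0 sqrtr_sqr. Qed.

Lemma normc_prod (R : rcfType) (I : Type) (r : seq I) (P : pred I)
  (F : I -> R[i]) :
  normc (\prod_(i <- r | P i) F i) = \prod_(i <- r | P i) normc (F i).
Proof.
by apply: complexI; rewrite rmorph_prod /= -normcE normr_prod.
Qed.

Lemma ler_normc_sum (R : rcfType) (I : Type) (r : seq I) (P : pred I)
  (F : I -> R[i]) :
  normc (\sum_(i <- r | P i) F i) <= \sum_(i <- r | P i) normc (F i).
Proof. by rewrite -lecR rmorph_sum /= -normcE ler_norm_sum. Qed.

Lemma ler_abs_Re (R : rcfType) (z : R[i]) : `|complex.Re z| <= normc z.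
Proof. by rewrite -lecR -normcE normc_ge_Re. Qed.

Lemma Re_sum (R : rcfType) (I : Type) (r : seq I) (P : pred I) (F : I -> R[i]) :
  complex.Re (\sum_(i <- r | P i) F i) = \sum_(i <- r | P i) complex.Re (F i).
Proof. by apply: (big_morph (@complex.Re R)) => // -[a b] [c d]. Qed.

Lemma ReMr (R : rcfType) (x : R) (z : R[i]) : complex.Re (x%:C%C * z) = x * complex.Re z.
Proof. by case: z => a b /=; rewrite mul0r subr0. Qed.

Lemma sqr_normcE (R : rcfType) (z : R[i]) :
  (normc z ^+ 2)%:C%C = z * z^*%C.
Proof. by rewrite -sqr_normc rmorphXn. Qed.

Section circle.
Variable R : realType.
Implicit Types (s t : R) (z : R[i]).

Local Notation cis := (@expi2pi R : R -> R[i]).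

Lemma cis0 : cis 0 = 1.
Proof. by rewrite /expi2pi mulr0 cos0 sin0. Qed.

Lemma cis1 : cis 1 = 1.
Proof. by rewrite /expi2pi mulr1 mulrC -mulr_natr mul1r mulr_natr cos2pi sin2pi. Qed.

Lemma cisD s t : cis (s + t) = cis s * cis t.
Proof.
rewrite /expi2pi mulrDr cosD sinD.
by apply/eqP; rewrite eq_complex /= eqxx [_ * cos _ + _]addrC eqxx.
Qed.

Lemma conj_cis t : (cis t)^*%C = cis (- t).
Proof. by rewrite /expi2pi mulrN cosN sinN. Qed.

Lemma normc_cis t : normc (cis t) = 1.
Proof. by rewrite /expi2pi /= cos2Dsin2 sqrtr1. Qed.

Lemma cisX t k : cis t ^+ k = cis (t * k%:R).
Proof.
elim: k => [|k IH]; first by rewrite expr0 mulr0 cis0.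
by rewrite exprS IH -cisD -natr1; congr cis; ring.
Qed.

(** The real part is [1 - 2 sin^2 (pi t)], and [sin] is positive strictly between 0 and [pi]. *)
Lemma cis_neq1 t : 0 < t < 1 -> cis t != 1.
Proof.
move=> /andP[t0 t1]; rewrite /expi2pi eq_complex /= negb_and; apply/orP; left.
have : 0 < sin (pi * t).
  by apply: sin_gt0_pi; rewrite mulr_gt0 ?pi_gt0 //= gtr_pMr ?pi_gt0.
have -> : 2 * pi * t = (pi * t) *+ 2 by rewrite -mulr_natl; ring.
rewrite cos_mulr2n => s0; rewrite neq_lt; apply/orP; left.
have := cos2Dsin2 (pi * t); have : 0 < sin (pi * t) ^+ 2 by rewrite exprn_gt0.
rewrite -mulr_natl; lra.
Qed.

Lemma conj_unit z : normc z = 1 -> z * z^*%C = 1.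
Proof. by move=> z1; rewrite -sqr_normcE z1 expr1n. Qed.

(** Circle averages are first taken over these points: Fourier orthogonality is then a finite
    identity, and integrals enter only through Riemann sums. *)
Definition uroot n (l : 'I_n) : R[i] := cis (l%:R / n%:R).

Lemma normc_uroot n (l : 'I_n) : normc (uroot l) = 1.
Proof. exact: normc_cis. Qed.

(** The summand is [q ^+ l] with [q = cis ((k - k') / n)]. Since [q ^+ n = 1], the geometric sum
    vanishes unless [q = 1], that is, [k = k']. *)
Lemma uroot_orthogonal n k k' : (k < n)%N -> (k' < n)%N ->
  \sum_(l < n) uroot l ^+ k * (uroot l ^+ k')^*%C = (n * (k == k'))%:R.
Proof.
move=> kn k'n; have n0 : 0 < n%:R :> R by rewrite ltr0n; case: n kn k'n.
pose q := cis ((k%:R - k'%:R) / n%:R).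
transitivity (\sum_(l < n) q ^+ l).
  apply: eq_bigr => l _; rewrite /q /uroot !cisX conj_cis -cisD; congr cis.
  by field; rewrite gt_eqF.
have [kk'|kk'] := eqVneq k k'.
  rewrite /q kk' subrr mul0r cis0; under eq_bigr do rewrite expr1n.
  by rewrite sumr_const card_ord muln1.
have cis_neq (a b : nat) : (a < b)%N -> (b < n)%N ->
    cis ((b%:R - a%:R) / n%:R) != 1.
  move=> ab bn; apply: cis_neq1.
  rewrite divr_gt0 ?subr_gt0 ?ltr_nat //= ltr_pdivrMr // mul1r.
  by rewrite ltrBlDr (lt_le_trans (y := n%:R)) ?ltr_nat// lerDl.
have q1 : q != 1.
  have [lt|lt|/eqP] := ltngtP k' k; [exact: cis_neq| |by rewrite eq_sym (negPf kk')].
  apply: contra (cis_neq _ _ lt k'n) => /eqP q1; apply/eqP.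
  by rewrite -[RHS]conjc1 -q1 conj_cis -mulNr opprB.
have /eqP : (q - 1) * (\sum_(l < n) q ^+ l) = 0.
  rewrite -subrX1 /q cisX mulfVK ?gt_eqF // cisD -conj_cis.
  have cis_nat j : cis j%:R = 1 by rewrite -[j%:R]mul1r -cisX cis1 expr1n.
  by rewrite !cis_nat conjc1 mulr1 subrr.
by rewrite mulf_eq0 subr_eq0 (negPf q1) muln0 /= => /eqP.
Qed.

Lemma sum_uroot n k : (0 < k < n)%N -> \sum_(l < n) uroot l ^+ k = 0.
Proof.
case: n => [|n] /andP[k0 kn]; first by [].
have := @uroot_orthogonal n.+1 k 0 kn isT.
under eq_bigr do rewrite expr0 conjc1 mulr1.
by rewrite eqn0Ngt k0 muln0.
Qed.

(** Cauchy's estimate in discrete form: for [n >= size p] and [n > i], the coefficient of index [i]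
    is the mean of [p(w) * conj (w^i)] over the [n]-th roots of unity. *)
Lemma normc_coef_le (p : {poly R[i]}) (L : R) :
  (forall z, normc z = 1 -> normc p.[z] <= L) ->
  forall i, normc p`_i <= L.
Proof.
move=> pL i; set n := maxn (size p) i.+1.
have n0 : (0 < n)%N by rewrite leq_max orbT.
have pn : (size p <= n)%N by rewrite leq_maxl.
have pE : n%:R * p`_i = \sum_(l < n) p.[uroot l] * (uroot l ^+ i)^*%C.
  under eq_bigr do rewrite (horner_coef_wide _ pn) mulr_suml.
  rewrite exchange_big /=.
  have iltn : (i < n)%N by rewrite leq_maxr.
  rewrite (bigD1 (Ordinal iltn)) //= [X in _ + X]big1 => [|j ji].
    rewrite addr0; under eq_bigr do rewrite -mulrA.
    by rewrite -mulr_sumr uroot_orthogonal // eqxx muln1 mulrC.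
  under eq_bigr do rewrite -mulrA.
  rewrite -mulr_sumr uroot_orthogonal //.
  by move: ji; rewrite -val_eqE => /negPf /= ->; rewrite muln0 mulr0.
have nE : normc (n%:R : R[i]) = n%:R.
  by rewrite -(rmorph_nat (real_complex R)) normc_real normr_nat.
rewrite -(@ler_pM2l _ n%:R) ?ltr0n // -[X in X * normc _]nE -normcM pE.
apply: (le_trans (ler_normc_sum _ _ _)).
apply: (@le_trans _ _ (\sum_(l < n) L)); last first.
  by rewrite sumr_const card_ord mulr_natl.
apply: ler_sum => l _.
by rewrite normcM normc_conj normcX normc_uroot expr1n mulr1 pL ?normc_uroot.
Qed.

End circle.

(** * The logarithmic potential *)

Section log.
Variable R : realType.
Implicit Types (z : R[i]).

Lemma normc_sqr z : normc z ^+ 2 = complex.Re z ^+ 2 + complex.Im z ^+ 2.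
Proof. by case: z => a b /=; rewrite sqr_sqrtr ?addr_ge0 ?sqr_ge0. Qed.

Lemma Re_div z w : complex.Re (z / w) = complex.Re (z * w^*%C) / normc w ^+ 2.
Proof.
rewrite invc_norm normcE -rmorphXn -fmorphV mulrCA.
by rewrite ReMr mulrC.
Qed.

Lemma normc_1B_ge z : 1 - normc z <= normc (1 - z).
Proof.
rewrite lerBlDr -[leLHS](@normc1 R); apply: le_trans (ler_normcD _ _).
by rewrite subrK.
Qed.

(* Mean value theorem for [t |-> ln |1 - tz| + \sum_(m < K) Re (tz)^(m+1) / (m+1)],
   whose derivative is [- Re (z (tz)^K / (1 - tz))]. *)
Lemma ln_normc_1B z K : normc z <= 2^-1 ->
  `| ln (normc (1 - z)) + \sum_(m < K) complex.Re (z ^+ m.+1) / m.+1%:R |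
  <= 2^-1 ^+ K.
Proof.
move=> z2; have z0 := normc_ge0 z.
(* [d] is [|1 - tz|^2] as a polynomial in [t], and [h] below is half its logarithm plus [S]. The
   coefficient of index 0 in [S] is [Re 1 / 0], which is 0 by the convention on inverses. *)
pose d : {poly R} := 1 - (2 * complex.Re z) *: 'X + (normc z ^+ 2) *: 'X^2.
pose S : {poly R} := \poly_(m < K.+1) (complex.Re (z ^+ m) / m%:R).
pose w (t : R) : R[i] := 1 - t%:C%C * z.
have tz (t : R) : t \in `[0, 1] -> normc (t%:C%C * z) <= normc z.
  rewrite in_itv /= => /andP[t0 t1].
  by rewrite normcM normc_real ger0_norm // ler_piMl.
have w_gt (t : R) : t \in `[0, 1] -> 2^-1 <= normc (w t).
  move=> /tz tz1; apply: le_trans (normc_1B_ge _); lra.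
have dE (t : R) : d.[t] = normc (w t) ^+ 2.
  rewrite /d /w !hornerE !normc_sqr; case: (z) => a b /=; ring.
have dE' (t : R) : 2^-1 * d^`().[t] = complex.Re (- z * (w t)^*%C).
  rewrite /d /w derivD derivB derivZ derivX derivZ derivXn -polyC1 derivC.
  rewrite !hornerE normc_sqr /=; by case: (z) => a b /=; field.
have SE' (t : R) :
    S^`().[t] = complex.Re (\sum_(m < K) z ^+ m.+1 * t%:C%C ^+ m).
  rewrite (_ : S^`() = \poly_(m < K) complex.Re (z ^+ m.+1)); last first.
    apply/polyP => i; rewrite coef_deriv !coef_poly ltnS.
    case: ifP => _; rewrite ?mul0rn //.
    by rewrite -mulrnAr -[_^-1 *+ _]mulr_natr mulVf ?mulr1 ?pnatr_eq0.
  rewrite horner_poly Re_sum; apply: eq_bigr => i _.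
  by rewrite mulrC -ReMr rmorphXn mulrC.
pose h : R -> R := 2^-1 \*: (@ln R \o horner d) + horner S.
pose dh (t : R) := 2^-1 * ((d.[t])^-1 * d^`().[t]) + S^`().[t].
have h_derive (t : R) : t \in `[0, 1] -> is_derive t (1:R) h (dh t).
  move=> t01; apply: is_deriveD.
  apply: is_deriveZ; apply: is_derive1_comp.
  apply: is_derive1_ln.
  by rewrite dE exprn_gt0 // (lt_le_trans _ (w_gt t t01)) // invr_gt0.
have hd (t : R) : t \in `]0, 1[ -> is_derive t (1:R) h (dh t).
  by move=> /subset_itv_oo_cc; exact: h_derive.
have hc : {within `[0, 1], continuous h}.
  apply: derivable_within_continuous => x /h_derive ?; exact: ex_derive.
have [c c01] := MVT_segment ler01 hd hc.
have -> : h 0 = 0.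
  rewrite /h !fctE /= dE /w mul0r subr0 normc1 expr1n ln1 scaler0 add0r.
  by rewrite horner_coef0 coef_poly /= invr0 mulr0.
have -> : h 1 = ln (normc (1 - z)) + \sum_(m < K) complex.Re (z ^+ m.+1) / m.+1%:R.
  rewrite /h !fctE /= dE lnXn; last first.
    by rewrite (lt_le_trans _ (w_gt 1 _)) ?invr_gt0 // in_itv /= lexx ler01.
  rewrite /w mul1r -[_ *: _]/(2^-1 * _) -[ln _ *+ _]mulr_natl.
  rewrite mulKf ?pnatr_eq0 //; congr (_ + _).
  rewrite horner_poly big_ord_recl invr0 mulr0 mul0r add0r.
  by apply: eq_bigr => i _; rewrite expr1n mulr1.
rewrite !subr0 mulr1 => ->.
have wc := w_gt c c01.
have w0 : w c != 0 by rewrite -normc_gt0 (lt_le_trans _ wc) // invr_gt0.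
have -> : dh c = complex.Re (- (z * (c%:C%C * z) ^+ K) / w c).
  rewrite /dh mulrCA dE' SE' mulrC dE -Re_div.
  rewrite -raddfD; congr (complex.Re _).
  apply: (mulIf w0); rewrite mulfVK // mulrDl mulfVK //.
  rewrite (_ : \sum_(m < K) _ = z * \sum_(m < K) (c%:C%C * z) ^+ m).
    rewrite /w; set x := c%:C%C * z; set G := \sum_(m < K) _.
    have -> : - z + z * G * (1 - x) = - z - z * ((x - 1) * G) by ring.
    by rewrite -subrX1; ring.
  by rewrite mulr_sumr; apply: eq_bigr => i _; rewrite exprS exprMn; ring.
apply: le_trans (ler_abs_Re _) _.
rewrite normcM normcV normcN normcM normcX.
rewrite ler_pdivrMr ?normc_gt0 //.
(* As [|z| <= 1/2 <= |w c|], the factor [|z| / |w c|] is at most 1, and [|cz|^K <= 2^-K] remains. *)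
have tzc : normc (c%:C%C * z) <= 2^-1 by apply: le_trans z2; exact: tz.
rewrite mulrC; apply: ler_pM => //; rewrite ?normc_ge0 ?exprn_ge0 ?normc_ge0 //.
  by rewrite lerXn2r ?nnegrE ?normc_ge0 ?invr_ge0.
by apply: le_trans wc.
Qed.
End log.

(** * Power sums of points in the closed unit disk *)

Section power_sums.
Variable R : realType.
Implicit Types (z : R[i]) (s : seq R[i]).

(** Lets a truncation order tend to infinity: a gap [x - y > 0] would exceed [C / 2^K] for large
    [K], because [K < 2^K]. *)
Lemma ler_of_geometric (x y C : R) :
  (forall K, x <= y + C * 2^-1 ^+ K) -> x <= y.
Proof.
move=> xy; rewrite leNgt; apply/negP => yx.
have [C0|C0] := leP C 0.
  by have := xy 0%N; rewrite expr0 mulr1; lra.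
have yx0 : 0 < x - y by rewrite subr_gt0.
pose K := Num.bound (C / (x - y)).
have : C / (x - y) < 2 ^+ K.
  have CK : C / (x - y) < K%:R by apply: archi_boundP; rewrite divr_ge0 // ltW.
  by apply: (lt_trans CK); rewrite -natrX ltr_nat ltn_expl.
rewrite ltr_pdivrMr // mulrC -ltr_pdivrMr ?exprn_gt0 // -exprVn => CK.
by have := xy K; lra.
Qed.

Lemma sum_Re_uroot n k (a : R[i]) : (0 < k < n)%N ->
  \sum_(l < n) complex.Re (uroot R l ^+ k * a) = 0.
Proof. by move=> kn; rewrite -Re_sum -mulr_suml sum_uroot // mul0r. Qed.

(** Orthogonality of real harmonics: twice the product of real parts is [Re (xy) + Re (y conj x)].
    The first term has frequency [k + m < n] and sums to 0; the second has frequency [m - k]. *)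
Lemma sum_ReM_uroot n k m (a c : R[i]) :
  (0 < k)%N -> (0 < m)%N -> (k + m < n)%N ->
  \sum_(l < n) complex.Re (uroot R l ^+ k * c) * complex.Re (uroot R l ^+ m * a)
  = n%:R / 2 * ((k == m)%:R * complex.Re (c^*%C * a)).
Proof.
move=> k0 m0 kmn.
have ReM x y : complex.Re x * complex.Re y =
    2^-1 * complex.Re (x * y) + 2^-1 * complex.Re (y * x^*%C) :> R.
  by case: x y => [? ?] [? ?] /=; field.
under eq_bigr do rewrite ReM.
rewrite big_split /= -!mulr_sumr.
under eq_bigr do rewrite mulrACA -exprD.
rewrite sum_Re_uroot ?kmn ?addn_gt0 ?k0 // mulr0 add0r.
rewrite -Re_sum.
rewrite (_ : \sum_(i < n) _ = (n%:R * (k == m)%:R)%:C%C * (c^*%C * a)).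
  by rewrite ReMr; ring.
under eq_bigr do rewrite rmorphM mulrACA.
rewrite -mulr_suml uroot_orthogonal; last 2 first.
- by apply: leq_ltn_trans kmn; rewrite leq_addl.
- by apply: leq_ltn_trans kmn; rewrite leq_addr.
by rewrite natrM rmorphM !rmorph_nat eq_sym [a * _]mulrC.
Qed.

Lemma ln_normc_prod (I : eqType) (r : seq I) (F : I -> R[i]) :
  {in r, forall i, F i != 0} ->
  ln (normc (\prod_(i <- r) F i)) = \sum_(i <- r) ln (normc (F i)).
Proof.
move=> F0; rewrite normc_prod.
elim: r F0 => [|i r IH] F0; first by rewrite !big_nil ln1.
have F0r : {in r, forall j, F j != 0}.
  by move=> j jr; apply: F0; rewrite inE jr orbT.
rewrite !big_cons lnM ?IH //.
  by rewrite posrE normc_gt0 F0 // mem_head.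
by rewrite posrE -normc_prod normc_gt0 prodf_seq_neq0; apply/allP.
Qed.

Lemma normc_half z : normc (z / 2) = normc z / 2.
Proof.
by rewrite normcM normcV -(rmorph_nat (real_complex R)) normc_real normr_nat.
Qed.

(* The weight [1 + Re (c w^k)] is nonnegative on the unit circle, and its
   average against [ln |1 - u xi|] over the circle [|u| = 1/2] is
   [- Re (c^* xi^k) / (k 2^(k+1))]. *)
Lemma power_sum_le s (M : R) k : (0 < k)%N ->
  {in s, forall xi, normc xi <= 1} ->
  (forall u : R[i], normc u = 2^-1 ->
     ln (normc (\prod_(xi <- s) (1 - u * xi))) <= M) ->
  normc (\sum_(xi <- s) xi ^+ k) <= 2 * k%:R * 2 ^+ k * M.
Proof.
move=> k0 s1 sM.
(* Halving the points brings them into the disk where the expansion of [ln |1 - z|] is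
   controlled. *)
pose a m := \sum_(xi <- s) (xi / 2) ^+ m.
have aE : a k = (2^-1 ^+ k)%:C%C * \sum_(xi <- s) xi ^+ k.
  rewrite mulr_sumr; apply: eq_bigr => xi _.
  by rewrite exprMn mulrC -[in LHS](rmorph_nat (real_complex R)) -fmorphV -rmorphXn.
suff: normc (a k) <= 2 * k%:R * M.
  rewrite aE normcM normc_real ger0_norm ?exprn_ge0 ?invr_ge0 //.
  rewrite exprVn mulrC ler_pdivrMr ?exprn_gt0 // => /le_trans; apply.
  by rewrite mulrAC.
apply: (@ler_of_geometric _ _ (4 * k%:R * (size s)%:R * 2 ^+ k)) => j.
(* [K >= k] keeps the frequency [k] in the truncated series; [n > K + k] keeps all sums of two
   frequencies below [n], which rules out aliasing. *)
pose K := (k + j)%N; pose n := (K + k).+1.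
pose v (l : 'I_n) := \sum_(xi <- s) ln (normc (1 - uroot R l * (xi / 2))).
have half n' (l : 'I_n') xi : xi \in s -> normc (uroot R l * (xi / 2)) <= 2^-1.
  by move=> /s1 ?; rewrite normcM normc_uroot mul1r normc_half; lra.
have vM l : v l <= M.
  have unit_half : normc (uroot R l / 2) = 2^-1.
    by rewrite normc_half normc_uroot mul1r.
  apply: le_trans (sM _ unit_half); rewrite ln_normc_prod => [|xi xis].
    by apply: ler_sum => xi _; rewrite mulrAC -mulrA.
  rewrite mulrAC -mulrA -normc_gt0; apply: lt_le_trans (normc_1B_ge _).
  by rewrite subr_gt0 (le_lt_trans (half _ _ _ xis)) // invf_lt1 // ltr1n.
pose V (l : 'I_n) :=
  \sum_(m < K) complex.Re (uroot R l ^+ m.+1 * a m.+1) / m.+1%:R.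
have vV l : - V l <= v l + (size s)%:R * 2^-1 ^+ K.
  have VE : V l = \sum_(xi <- s) \sum_(m < K)
      complex.Re ((uroot R l * (xi / 2)) ^+ m.+1) / m.+1%:R.
    rewrite exchange_big; apply: eq_bigr => m _ /=.
    rewrite -mulr_suml -Re_sum; congr (complex.Re _ / _).
    by rewrite /a mulr_sumr; apply: eq_bigr => xi _; rewrite [RHS]exprMn.
  rewrite -subr_ge0 opprK addrAC VE /v -big_split /=.
  have -> : (size s)%:R * 2^-1 ^+ K = \sum_(xi <- s) 2^-1 ^+ K :> R.
    by rewrite big_const_seq count_predT iter_addr_0 mulr_natl.
  rewrite -big_split /= big_seq.
  apply: sumr_ge0 => xi /(half _ l) xi2.
  by have := ln_normc_1B K xi2; rewrite ler_norml; lra.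
(* [c] points opposite to [a k], so that the weighted mean of [V] is [- |a k| / (2 k)]. *)
have [c c1 cE] : exists2 c, normc c = 1 & complex.Re (c^*%C * a k) = - normc (a k).
  have [->|ak0] := eqVneq (a k) 0.
    by exists 1; rewrite ?normc1 // mulr0 normc0 oppr0.
  exists (- (a k / (normc (a k))%:C%C)).
    rewrite normcN normcM normcV normc_real ger0_norm ?normc_ge0 //.
    by rewrite divff // gt_eqF // normc_gt0.
  rewrite rmorphN mulNr rmorphM mulrAC [_^*%C * a k]mulrC -sqr_normcE.
  rewrite [X in _ * X]conjc_inv conjc_real -fmorphV -rmorphM -rmorphN /= expr2 mulfK //.
  by rewrite gt_eqF // normc_gt0.
pose W (l : 'I_n) := 1 + complex.Re (uroot R l ^+ k * c).
have W0 l : 0 <= W l.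
  have := ler_abs_Re (uroot R l ^+ k * c).
  rewrite normcM normcX normc_uroot c1 expr1n mulr1 /W ler_norml; lra.
have kK : (k <= K)%N by rewrite leq_addr.
have sumW : \sum_(l < n) W l = n%:R.
  rewrite big_split /= sum_Re_uroot ?addr0 ?sumr_const ?card_ord //.
  by rewrite k0 ltnS leq_addl.
have sumWV : \sum_(l < n) W l * V l = - (n%:R / 2 * normc (a k) / k%:R).
  rewrite (eq_bigr (fun l => \sum_(m < K)
    (W l * complex.Re (uroot R l ^+ m.+1 * a m.+1)) / m.+1%:R)); last first.
    by move=> l _; rewrite mulr_sumr; apply: eq_bigr => m _; rewrite mulrA.
  rewrite exchange_big /=.
  rewrite (eq_bigr (fun m : 'I_K => n%:R / 2 *
    ((k == m.+1)%:R * complex.Re (c^*%C * a m.+1)) / m.+1%:R)); last first.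
    move=> m _; rewrite -mulr_suml; congr (_ / _).
    under eq_bigr do rewrite mulrDl mul1r.
    rewrite big_split /= sum_Re_uroot ?add0r; last first.
      by rewrite /= /n ltnS; apply: leq_trans (ltn_ord m) (leq_addr _ _).
    by rewrite sum_ReM_uroot // addnC ltnS leq_add2r.
  case: (k) k0 kK cE => // k' _ k'K cE.
  rewrite (bigD1 (Ordinal k'K)) //= [X in _ + X]big1 => [|m mk].
    by rewrite addr0 eqxx mul1r cE mulrN mulNr.
  have /negPf -> : k'.+1 != m.+1 by move: mk; rewrite -val_eqE /= eqSS eq_sym.
  by rewrite mul0r mulr0 mul0r.
(* With [err] the truncation error, [V l >= - v l - err >= - M - err]; summing against the
   nonnegative weights bounds [|a k| / (2 k)] by [M + err]. *)
have : 0 <= \sum_(l < n) W l * (M + (size s)%:R * 2^-1 ^+ K + V l).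
  apply: sumr_ge0 => l _; apply: mulr_ge0 => //.
  by have := vM l; have := vV l; lra.
under eq_bigr do rewrite mulrDr.
rewrite big_split /= -mulr_suml sumW sumWV.
have -> : n%:R * (M + (size s)%:R * 2^-1 ^+ K) - n%:R / 2 * normc (a k) / k%:R =
    n%:R * (M + (size s)%:R * 2^-1 ^+ K - normc (a k) / (2 * k%:R)).
  by field; rewrite pnatr_eq0 -lt0n k0.
rewrite pmulr_rge0 ?ltr0n // subr_ge0 ler_pdivrMr ?mulr_gt0 ?ltr0n //.
move=> /le_trans; apply; rewrite exprD.
have k1 : 2^-1 ^+ k <= 2 ^+ k :> R.
  apply: (@le_trans _ _ 1); first by rewrite exprn_ile1 ?invr_ge0 ?invf_le1 ?ler1n.
  by rewrite exprn_ege1 // ler1n.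
have : 0 <= k%:R * (size s)%:R * 2^-1 ^+ j * (2 ^+ k - 2^-1 ^+ k) :> R.
  by rewrite mulr_ge0 ?subr_ge0 // ?mulr_ge0 ?exprn_ge0 ?invr_ge0.
have : 0 <= k%:R * (size s)%:R * 2^-1 ^+ j * 2 ^+ k :> R.
  by rewrite ?mulr_ge0 ?exprn_ge0 ?invr_ge0.
lra.
Qed.
End power_sums.

(** * Polynomials bounded on the unit circle *)

Section roots.
Variable R : realType.
Implicit Types (z w : R[i]) (s : seq R[i]).

(* Inversion in the unit circle moves the root [z] off the open disk without
   changing [|w - z| / max 1 |z|] for [|w| = 1]; [inner z] is the inverse of the
   moved root. *)
Definition inner z : R[i] := if normc z < 1 then z^*%C else z^-1.

(** The Mahler measure of the monic polynomial with roots [s]. *)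
Definition mahler s : R := \prod_(z <- s) Num.max 1 (normc z).

(** Radial projection onto the circle; 0 is sent to 0 by the convention on division. *)
Definition unitc z : R[i] := z / (normc z)%:C%C.

Lemma normc_inner_le1 z : normc (inner z) <= 1.
Proof.
rewrite /inner; case: ltP => z1; first by rewrite normc_conj ltW.
by rewrite normcV invf_le1 // (lt_le_trans ltr01).
Qed.

(** If [|z| < 1], multiply [w - z] by [conj w], of modulus 1, and conjugate; otherwise factor out
    [z]. *)
Lemma normc_sub_inner w z : normc w = 1 ->
  normc (w - z) = Num.max 1 (normc z) * normc (1 - w * inner z).
Proof.
move=> w1; rewrite /inner; case: ltP => z1.
  rewrite mul1r -[RHS]normc_conj rmorphB rmorph1 rmorphM /= conjcK.
  rewrite -[LHS]mul1r -w1 -(normc_conj w) -normcM mulrBr [_ * w]mulrC conj_unit //.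
have z0 : z != 0 by rewrite -normc_gt0 (lt_le_trans ltr01).
by rewrite -normcM mulrBr mulr1 mulrCA mulfV // mulr1 normcB.
Qed.

Lemma mahler_ge1 s : 1 <= mahler s.
Proof.
rewrite /mahler; elim: s => [|z s IH]; first by rewrite big_nil.
by rewrite big_cons mulr_ege1 // le_max lexx.
Qed.

(** Normalized to have value 1 at 0; since [|inner z| <= 1], it has no zero in the open disk. *)
Definition inner_poly s : {poly R[i]} := \prod_(z <- s) (1 - inner z *: 'X).

Lemma horner_inner_poly s w :
  (inner_poly s).[w] = \prod_(z <- s) (1 - w * inner z).
Proof.
rewrite /inner_poly horner_prod; apply: eq_bigr => z _.
by rewrite !hornerE mulrC.
Qed.

Variables (s : seq R[i]) (L : R).
Hypothesis s_le : forall w, normc w = 1 -> normc (\prod_(z <- s) (w - z)) <= L.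

(** On the circle, [|inner_poly s|] is [|\prod (w - z)| / mahler s]; Cauchy's estimate applies. *)
Lemma coef_inner_poly_le i : normc (inner_poly s)`_i <= L / mahler s.
Proof.
apply: normc_coef_le => w w1.
have M0 := lt_le_trans ltr01 (mahler_ge1 s).
rewrite horner_inner_poly ler_pdivlMr // mulrC; apply: le_trans (s_le w1).
rewrite !normc_prod -big_split /=.
by under [leRHS]eq_bigr do rewrite normc_sub_inner //.
Qed.

(** The constant coefficient of [inner_poly s] is 1, so its bound [L / mahler s] is at least 1. *)
Lemma mahler_le : mahler s <= L.
Proof.
have M0 := lt_le_trans ltr01 (mahler_ge1 s).
have := coef_inner_poly_le 0; rewrite -horner_coef0 horner_inner_poly.
under eq_bigr do rewrite mul0r subr0.
by rewrite big1 // normc1 ler_pdivlMr // mul1r.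
Qed.

(** Takes the place of the maximum principle: each coefficient is at most [L], and the powers of
    [1/2] sum to at most 2. *)
Lemma inner_poly_half_le w : normc w = 2^-1 -> normc (inner_poly s).[w] <= 2 * L.
Proof.
move=> w2; rewrite horner_coef; apply: (le_trans (ler_normc_sum _ _ _)).
have M1 := mahler_ge1 s; have M0 := lt_le_trans ltr01 M1.
have L0 : 0 <= L by apply: le_trans mahler_le; exact: ltW.
apply: (@le_trans _ _ (\sum_(i < size (inner_poly s)) L * 2^-1 ^+ i)).
  apply: ler_sum => i _; rewrite normcM normcX w2.
  rewrite ler_wpM2r ?exprn_ge0 ?invr_ge0 //.
  by apply: le_trans (coef_inner_poly_le i) _; rewrite ler_pdivrMr // ler_peMr.
rewrite -mulr_sumr mulrC ler_wpM2r //.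
move: (size _) => n; have := subrX1 (2^-1 : R) n.
have : 0 <= 2^-1 ^+ n :> R by rewrite exprn_ge0 // invr_ge0.
move: (2^-1 ^+ n) (\sum_(i < n) _) => x y; lra.
Qed.

Hypothesis s0 : 0 \notin s.

(** Controls both the radial spread and the angular power sums of the roots. For a polynomial it
    involves only a bound on the circle and the two extreme coefficients. *)
Definition root_height : R := 2 * ln (2 * L) - ln (\prod_(z <- s) normc z).

Lemma ln_2L_ge0 : 0 <= ln (2 * L).
Proof.
by have L1 := le_trans (mahler_ge1 s) mahler_le; rewrite ln_ge0 //; lra.
Qed.

(** Sum [|ln x| = 2 ln (max 1 x) - ln x] over the moduli, then use [mahler s <= L]. *)
Lemma sum_abs_ln : \sum_(z <- s) `|ln (normc z)| <= root_height.
Proof.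
have z_gt0 z : z \in s -> 0 < normc z.
  by move=> zs; rewrite normc_gt0; apply: contraNneq s0 => <-.
rewrite /root_height -normc_prod ln_normc_prod => [|z /z_gt0]; last first.
  by rewrite normc_gt0.
have M1 := mahler_ge1 s; have ML := mahler_le.
apply: (@le_trans _ _ (2 * ln (mahler s) - \sum_(z <- s) ln (normc z))).
  have -> : mahler s = normc (\prod_(z <- s) (Num.max 1 (normc z))%:C%C).
    rewrite normc_prod; apply: eq_bigr => z _.
    by rewrite normc_real ger0_norm // le_max ler01.
  rewrite ln_normc_prod => [|z _]; last first.
    by rewrite -normc_gt0 normc_real normr_gt0 gt_eqF // lt_max ltr01.
  rewrite mulr_sumr -sumrB ler_sum // => z _.
  rewrite normc_real [`|Num.max _ _|]ger0_norm; last by rewrite le_max ler01.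
  case: (leP 1 (normc z)) => z1; first by rewrite ger0_norm ?ln_ge0 //; lra.
  by rewrite ln1 mulr0 sub0r ler0_norm // ln_le0 // ltW.
have : ln (mahler s) <= ln (2 * L) by rewrite ler_ln ?posrE; lra.
lra.
Qed.

Lemma ln_2L_le_height : ln (2 * L) <= root_height.
Proof.
have M1 := mahler_ge1 s; have ML := mahler_le.
suff : ln (\prod_(z <- s) normc z) <= ln (2 * L) by rewrite /root_height; lra.
have sM : \prod_(z <- s) normc z <= mahler s.
  by apply: ler_prod => z _; rewrite normc_ge0 le_max lexx orbT.
rewrite ler_ln ?posrE; [lra| |lra].
rewrite -normc_prod normc_gt0 prodf_seq_neq0; apply/allP => z zs /=.
by apply: contraNneq s0 => <-.
Qed.

(** [inner z] is the conjugate of [unitc z] shrunk by [exp (- |ln |z||)]. Its power sums are bounded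
    through [ln (2 L)], and undoing the shrinking costs at most [k |ln |z||] per root, by
    [1 - exp (- x) <= x]. *)
Lemma power_sum_unitc_le k : (0 < k)%N ->
  normc (\sum_(z <- s) unitc z ^+ k) <= (2 * k%:R * 2 ^+ k + k%:R) * root_height.
Proof.
move=> k0.
have inner_le : normc (\sum_(z <- s) inner z ^+ k) <= 2 * k%:R * 2 ^+ k * ln (2 * L).
  rewrite -(big_map inner xpredT (fun xi => xi ^+ k)).
  apply: power_sum_le => // [xi /mapP[z _ ->]|u u2]; first exact: normc_inner_le1.
  rewrite big_map -horner_inner_poly ler_ln ?posrE.
  - exact: inner_poly_half_le.
  - rewrite horner_inner_poly normc_gt0 prodf_seq_neq0; apply/allP => z _ /=.
    rewrite -normc_gt0; apply: lt_le_trans (normc_1B_ge _).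
    rewrite normcM u2; have := normc_inner_le1 z; lra.
  - by have := le_trans (mahler_ge1 s) mahler_le; lra.
have diff z : z \in s ->
    normc ((unitc z)^*%C ^+ k - inner z ^+ k) <= k%:R * `|ln (normc z)|.
  move=> zs; have z0 : 0 < normc z.
    by rewrite normc_gt0; apply: contraNneq s0 => <-.
  have zC : (normc z)%:C%C != 0 by rewrite -normc_gt0 normc_real normr_gt0 gt_eqF.
  have -> : inner z = (unitc z)^*%C * (expR (- `|ln (normc z)|))%:C%C.
    rewrite /unitc rmorphM [X in _ * X * _]conjc_inv conjc_real /inner.
    case: ltP => z1.
      rewrite ler0_norm ?opprK ?lnK ?posrE //; last by rewrite ln_le0 // ltW.
      by rewrite mulfVK.
    rewrite ger0_norm ?ln_ge0 // expRN lnK ?posrE //.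
    by rewrite [z^-1]invc_norm normcE fmorphV expr2 invfM [LHS]mulrC mulrA.
  rewrite exprMn -[X in X - _]mulr1 -mulrBr normcM normcX normc_conj.
  have -> : normc (unitc z) = 1.
    by rewrite /unitc normcM normcV normc_real gtr0_norm // divff // gt_eqF.
  rewrite expr1n mul1r -rmorphXn -(rmorph1 (real_complex R)) -rmorphB normc_real.
  rewrite -expRM_natl mulrN.
  set x := k%:R * _.
  have x0 : 0 <= x by rewrite mulr_ge0.
  have := expR_ge1Dx (- x).
  have : expR (- x) <= 1 by rewrite -expR0 ler_expR oppr_le0.
  move=> e1 e2; rewrite ger0_norm; lra.
rewrite -normc_conj rmorph_sum /=.
rewrite (eq_bigr (fun z => inner z ^+ k + ((unitc z)^*%C ^+ k - inner z ^+ k))); last first.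
  by move=> z _; rewrite rmorphXn addrC subrK.
rewrite big_split /=; apply: (le_trans (ler_normcD _ _)).
rewrite mulrDl; apply: lerD.
  apply: (le_trans inner_le); apply: ler_wpM2l; first by rewrite !mulr_ge0 ?exprn_ge0.
  exact: ln_2L_le_height.
apply: (le_trans (ler_normc_sum _ _ _)).
apply: (@le_trans _ _ (\sum_(z <- s) k%:R * `|ln (normc z)|)).
  by rewrite big_seq [leRHS]big_seq ler_sum.
by rewrite -mulr_sumr ler_wpM2l // sum_abs_ln.
Qed.
End roots.

(** * Fejer kernel *)

Section fejer.
Variable R : realType.
Implicit Types (x z a : R[i]) (t : seq R[i]).

(** On the circle this is the Fejer kernel, the sum of [(1 - |k| / N) z^k] over [|k| < N]; as a
    square it is visibly nonnegative. *)
Definition fejer N z : R := normc (\sum_(k < N) z ^+ k) ^+ 2 / N%:R.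

Lemma fejer_ge0 N z : 0 <= fejer N z.
Proof. by rewrite divr_ge0 ?exprn_ge0 ?normc_ge0. Qed.

Lemma fejer_conj N z : fejer N z^*%C = fejer N z.
Proof.
rewrite /fejer -[in RHS]normc_conj rmorph_sum; congr (normc _ ^+ _ / _).
by apply: eq_bigr => k _; rewrite rmorphXn.
Qed.

(** The geometric sum satisfies [|z - 1| |\sum z^k| = |z^N - 1| <= 2]. *)
Lemma fejer_far_le N z (d : R) : (0 < N)%N -> 0 < d -> normc z = 1 ->
  d <= normc (z - 1) -> fejer N z <= 4 / (N%:R * d ^+ 2).
Proof.
move=> N0 d0 z1 dz; rewrite invfM mulrA mulrAC ler_wpM2r ?invr_ge0 //.
rewrite ler_pdivlMr ?exprn_gt0 // -exprMn.
rewrite (_ : 4 = 2 ^+ 2) -1?natrX //.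
rewrite natrX lerXn2r ?nnegrE ?mulr_ge0 ?normc_ge0 ?(ltW d0) //.
have : normc (z - 1) * normc (\sum_(k < N) z ^+ k) <= 2.
  rewrite -normcM -subrX1; apply: (le_trans (ler_normcD _ _)).
  by rewrite normcX z1 expr1n normcN normc1.
by apply: le_trans; rewrite mulrC ler_wpM2r ?normc_ge0.
Qed.

Lemma fejerE N z : (fejer N z)%:C%C =
  (\sum_(k < N) \sum_(k' < N) z ^+ k * (z ^+ k')^*%C) / N%:R.
Proof.
rewrite rmorphM /= sqr_normcE fmorphV rmorph_nat; congr (_ / _).
rewrite rmorph_sum mulr_suml; apply: eq_bigr => k _.
by rewrite mulr_sumr.
Qed.

(** In the expanded square the diagonal contributes exactly [size t]. Each off-diagonal entry is, up
    to a unimodular factor and conjugation, a power sum of index [|k - k'| < N]; there are at most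
    [N^2], and the kernel divides by [N]. *)
Lemma fejer_sum N t a (B : R) : (0 < N)%N -> 0 <= B -> normc a = 1 ->
  {in t, forall x, normc x = 1} ->
  (forall k, (0 < k < N)%N -> normc (\sum_(x <- t) x ^+ k) <= B) ->
  `|\sum_(x <- t) fejer N (x * a) - (size t)%:R| <= N%:R * B.
Proof.
move=> N0 B0 a1 t1 tB.
have NC : N%:R != 0 :> R[i] by rewrite pnatr_eq0 -lt0n.
pose c (k k' : 'I_N) := if k == k' then 0 else
  (a ^+ k * (a ^+ k')^*%C) * \sum_(x <- t) x ^+ k * (x ^+ k')^*%C.
have cE : (\sum_(x <- t) fejer N (x * a) - (size t)%:R)%:C%C =
    (\sum_k \sum_k' c k k') / N%:R :> R[i].
  have -> : (size t)%:R = (\sum_(k < N) (size t)%:R) / N%:R :> R.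
    by rewrite sumr_const card_ord -(mulr_natr (size t)%:R N) mulfK // pnatr_eq0 -lt0n.
  rewrite rmorphB rmorph_sum /=.
  under eq_bigr do rewrite fejerE.
  rewrite -mulr_suml rmorphM /= fmorphV rmorph_nat -mulrBl; congr (_ / _).
  rewrite exchange_big rmorph_sum -sumrB; apply: eq_bigr => k _ /=.
  rewrite exchange_big (bigD1 k) //= [RHS](bigD1 k) //= {1}/c eqxx add0r.
  rewrite addrAC -[RHS]add0r; congr (_ + _).
    apply/eqP; rewrite subr_eq0 rmorph_nat; apply/eqP.
    rewrite -(count_predT t) -[RHS]addr0 -iter_addr -big_const_seq.
    rewrite big_seq [RHS]big_seq.
    apply: eq_bigr => x xt.
    by rewrite conj_unit // normcX normcM t1 // a1 mulr1 expr1n.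
  apply: eq_bigr => k' kk'; rewrite /c eq_sym (negPf kk') mulr_sumr.
  apply: eq_bigr => x _; rewrite !exprMn rmorphM /=; ring.
rewrite -normc_real cE normcM normcV.
rewrite -(rmorph_nat (real_complex R)) normc_real normr_nat ler_pdivrMr ?ltr0n //.
apply: (le_trans (ler_normc_sum _ _ _)).
have pow_sub (k k' : 'I_N) : (k' < k)%N ->
    normc (\sum_(x <- t) x ^+ k * (x ^+ k')^*%C) <= B.
  move=> kk'; rewrite (_ : \sum_(x <- t) _ = \sum_(x <- t) x ^+ (k - k')).
    by apply: tB; rewrite subn_gt0 kk' (leq_ltn_trans (leq_subr _ _)).
  rewrite big_seq [RHS]big_seq; apply: eq_bigr => x xt.
  rewrite -[in X in X * _](subnK (ltnW kk')) exprD -mulrA conj_unit ?mulr1 //.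
  by rewrite normcX t1 // expr1n.
have cB k k' : normc (c k k') <= B.
  rewrite /c; case: eqVneq => kk'; first by rewrite normc0.
  rewrite !normcM normc_conj !normcX a1 !expr1n !mul1r.
  have [/pow_sub//|lt|/val_inj e] := ltngtP k' k; last by rewrite e eqxx in kk'.
  rewrite -normc_conj rmorph_sum /=.
  under eq_bigr do rewrite rmorphM /= conjcK mulrC.
  exact: pow_sub.
apply: (@le_trans _ _ (\sum_(k < N) \sum_(k' < N) B)).
  apply: ler_sum => k _; apply: (le_trans (ler_normc_sum _ _ _)).
  exact: ler_sum.
by rewrite !sumr_const !card_ord -(mulr_natl B) -(mulr_natr (_ * B)).
Qed.

(** The roots of unity have vanishing power sums of index below [N <= n], so the previous estimate
    holds with bound 0. *)
Lemma fejer_sum_uroot N n z : (0 < N <= n)%N -> normc z = 1 ->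
  \sum_(l < n) fejer N (z * (uroot R l)^*%C) = n%:R.
Proof.
move=> /andP[N0 Nn] z1.
have := @fejer_sum N [seq uroot R l | l <- enum 'I_n] z^*%C 0 N0 (lexx _).
rewrite normc_conj => /(_ z1); rewrite size_map size_enum_ord.
under eq_bigr do rewrite -fejer_conj rmorphM /= conjcK mulrC.
rewrite mulr0 normr_le0 subr_eq0 big_map big_enum /= => H; apply/eqP/H.
  by move=> x /mapP[l _ ->]; exact: normc_uroot.
move=> k /andP[k0 kN]; rewrite big_map big_enum /= sum_uroot ?normc0 //.
by rewrite k0 (leq_trans kN).
Qed.

Variables (f : R[i] -> R) (B e d : R).
Hypotheses (d_gt0 : 0 < d) (f_le : forall z, `|f z| <= B).
Hypothesis f_unif : forall x y, normc x = 1 -> normc y = 1 ->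
  normc (x - y) < d -> `|f x - f y| <= e.

(** The kernel values are nonnegative weights of total [n]. Nodes within [d] of [z] are handled by
    uniform continuity; at the others [f] varies by at most [2 B] and the kernel is at most
    [4 / (N d^2)]. *)
Lemma fejer_approx N n z : (0 < N <= n)%N -> normc z = 1 ->
  `|n%:R * f z - \sum_(l < n) f (uroot R l) * fejer N (z * (uroot R l)^*%C)|
  <= n%:R * (e + 8 * B / (N%:R * d ^+ 2)).
Proof.
move=> Nn z1; have N0 : (0 < N)%N by case/andP: Nn.
have B0 : 0 <= B by apply: le_trans (f_le 0).
rewrite -{1}(fejer_sum_uroot Nn z1) mulr_suml -sumrB.
apply: le_trans (ler_norm_sum _ _ _) _.
apply: (@le_trans _ _ (\sum_(l < n) (e * fejer N (z * (uroot R l)^*%C)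
    + 2 * B * (4 / (N%:R * d ^+ 2))))); last first.
  rewrite big_split /= -mulr_sumr (fejer_sum_uroot Nn z1) sumr_const card_ord.
  by rewrite -(mulr_natl (2 * B * _)); lra.
apply: ler_sum => l _; set F := fejer _ _.
have F0 : 0 <= F by exact: fejer_ge0.
have u1 := normc_uroot R l.
have e0 : 0 <= e by apply: le_trans (f_unif z1 z1 _); rewrite // subrr normc0.
have C0 : 0 <= 2 * B * (4 / (N%:R * d ^+ 2)).
  by rewrite !mulr_ge0 ?invr_ge0 ?mulr_ge0 ?exprn_ge0 // ltW.
rewrite mulrC -mulrBl normrM (ger0_norm F0).
have [close|far] := ltP (normc (z - uroot R l)) d.
  by rewrite ler_wpDr // ler_wpM2r // f_unif.
apply: ler_wpDl; first exact: mulr_ge0.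
apply: ler_pM => //.
  apply: le_trans (ler_normB _ _) _.
  by have := f_le z; have := f_le (uroot R l); lra.
apply: fejer_far_le => //.
  by rewrite normcM normc_conj z1 u1 mulr1.
rewrite -(conj_unit u1) -mulrBl normcM normc_conj u1 mulr1 //.
Qed.

(** Replace [f] by its kernel average at each point, then exchange the sums: for each node the total
    kernel mass over [t] is nearly [size t]. *)
Lemma fejer_mean N n t (W : R) : (0 < N <= n)%N -> 0 <= W ->
  {in t, forall x, normc x = 1} ->
  (forall k, (0 < k < N)%N -> normc (\sum_(x <- t) x ^+ k) <= W) ->
  `|\sum_(x <- t) f x - (size t)%:R * (n%:R^-1 * \sum_(l < n) f (uroot R l))|
  <= (size t)%:R * (e + 8 * B / (N%:R * d ^+ 2)) + B * (N%:R * W).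
Proof.
move=> /[dup] Nn /andP[N0 Nlen] W0 t1 tW.
have n0 : 0 < n%:R :> R by rewrite ltr0n (leq_trans N0).
have B0 : 0 <= B by apply: le_trans (f_le 0).
rewrite -(ler_pM2l n0) -[X in X * `|_|](gtr0_norm n0) -normrM.
set G := fun z => \sum_(l < n) f (uroot R l) * fejer N (z * (uroot R l)^*%C).
have -> : n%:R * (\sum_(x <- t) f x - (size t)%:R * (n%:R^-1 * \sum_(l < n) f (uroot R l)))
  = \sum_(x <- t) (n%:R * f x - G x) +
    (\sum_(x <- t) G x - (size t)%:R * \sum_(l < n) f (uroot R l)).
  rewrite sumrB -mulr_sumr; field; by rewrite gt_eqF.
apply: le_trans (ler_normD _ _) _; rewrite mulrDr; apply: lerD.
  apply: le_trans (ler_norm_sum _ _ _) _.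
  apply: (@le_trans _ _ (\sum_(x <- t) n%:R * (e + 8 * B / (N%:R * d ^+ 2)))).
    rewrite big_seq [leRHS]big_seq ler_sum // => x xt.
    by apply: fejer_approx => //; apply: t1.
  by rewrite big_const_seq count_predT iter_addr_0 -(mulr_natl (n%:R * _)); lra.
rewrite exchange_big mulr_sumr -sumrB.
apply: le_trans (ler_norm_sum _ _ _) _.
apply: (@le_trans _ _ (\sum_(l < n) B * (N%:R * W))); last first.
  by rewrite sumr_const card_ord -(mulr_natl (B * _)).
apply: ler_sum => l _; rewrite -mulr_sumr [_ * f _]mulrC -mulrBr normrM.
by apply: ler_pM => //; apply: fejer_sum; rewrite // normc_conj normc_uroot.
Qed.

End fejer.

(** * Continuous functions on the unit circle *)

Section circle_topology.
Variable R : realType.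
Local Notation mu := (@lebesgue_measure R).
Local Notation cis := (@expi2pi R : R -> R[i]).

Lemma nbhs_normcP (x : R[i]) (P : set R[i]) : nbhs x P ->
  exists2 e : R, 0 < e & forall y, normc (x - y) < e -> P y.
Proof.
move=> /nbhs_ballP[[e e']] /=; rewrite ltcE /= => /andP[/eqP -> e0] eP.
by exists e => // y xy; apply: eP; rewrite -ball_normE /= normcE ltcR.
Qed.

Lemma near_normc (T : Type) (F : set_system T) (FF : Filter F) (f : T -> R[i])
  (x : R[i]) (e : R) : f t @[t --> F] --> x -> 0 < e ->
  \forall t \near F, normc (x - f t) < e.
Proof.
move=> /cvgrPdist_lt /(_ e%:C%C) fx e0.
have := fx _; rewrite ltcR => /(_ e0); apply: filterS => t.
by rewrite normcE ltcR.
Qed.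

Lemma cis_surj (x : R[i]) : normc x = 1 -> exists2 t : R, t \in `[0, 1] & cis t = x.
Proof.
case: x => a b ab.
have ab1 : a ^+ 2 + b ^+ 2 = 1.
  by have := normc_sqr (Complex a b); rewrite ab expr1n /= => <-.
have a1 : -1 <= a <= 1.
  rewrite -ler_norml -(@ler_pXn2r _ 2) ?nnegrE // expr1n.
  by rewrite real_normK ?num_real //; have := sqr_ge0 b; lra.
have pi0 := pi_gt0 R.
have sinE : sin (acos a) = `|b|.
  by rewrite sin_acos // -sqrtr_sqr; congr Num.sqrt; lra.
have cosE : cos (acos a) = a by rewrite acosK // in_itv.
have a0 := acos_ge0 a1; have api := acos_lepi a1.
have pi2 : 2 * pi != 0 :> R by rewrite gt_eqF // mulr_gt0.
have tE (u : R) : 2 * pi * (u / (2 * pi)) = u by rewrite mulrC divfK.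
have [b0|b0] := leP 0 b.
  exists (acos a / (2 * pi)).
    rewrite in_itv /= divr_ge0 ?mulr_ge0 ?(ltW pi0) //= ler_pdivrMr ?mulr_gt0 //; lra.
  by rewrite /expi2pi tE cosE sinE ger0_norm.
(* For points in the lower half plane the angle is [- acos a]; one full turn brings the parameter
   into [[0, 1]]. *)
exists (- acos a / (2 * pi) + 1).
  rewrite in_itv /= -lerBlDr sub0r mulNr lerN2 ler_pdivrMr ?mulr_gt0 //.
  have : 0 <= acos a / (2 * pi) by rewrite divr_ge0 ?mulr_ge0 ?(ltW pi0).
  lra.
rewrite cisD cis1 mulr1 /expi2pi tE cosN sinN cosE sinE ltr0_norm // opprK //.
Qed.

(** Only [x] lies on the circle: [z] may be a root near it. Half of a local continuity radius is
    spent on moving [x], half on [z], and compactness of [[0, 1]] makes the radius uniform. *)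
Lemma circle_uniform (f : R[i] -> R) (e : R) : continuous f -> 0 < e ->
  exists2 d, 0 < d & forall x z, normc x = 1 -> normc (x - z) < d ->
    `|f x - f z| <= e.
Proof.
move=> cf e0.
have : \forall d \near (0:R)^'+, `[0, 1]%classic `<=`
    (fun t : R => forall z, normc (cis t - z) < d -> `|f (cis t) - f z| <= e).
  apply: (compact_near_coveringP _).1; first exact: segment_compact.
  move=> t _.
  have [r r0 rP] : exists2 r : R, 0 < r &
      forall y, normc (cis t - y) < r -> `|f (cis t) - f y| < e / 2.
    by apply: nbhs_normcP; have /cvgrPdist_lt := cf (cis t); apply; rewrite divr_gt0.
  have r2 : 0 < r / 2 by rewrite divr_gt0.
  have cis_near : \forall u \near t, normc (cis t - cis u) < r / 2.
    exact: near_normc (@continuous_expi2pi R t) r2.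
  exists ([set u | normc (cis t - cis u) < r / 2], [set d | d < r / 2]) => /=.
    split; first exact: cis_near.
    exact: nbhs_right_lt.
  move=> [u d] /= [tu dr] z uz.
  rewrite -(subrKA (f (cis t))) (le_trans (ler_normD _ _)) // [leRHS]splitr.
  rewrite lerD //; last first.
    rewrite ltW // rP // -(subrKA (cis u)) (le_lt_trans (ler_normcD _ _)) //.
    by rewrite [ltRHS]splitr ltrD // (lt_trans uz).
  by rewrite distrC ltW // rP // (lt_trans tu) //; lra.
move=> near0; have [d d0 dP] : exists2 d : R, 0 < d & `[0, 1]%classic `<=`
    (fun t : R => forall z, normc (cis t - z) < d -> `|f (cis t) - f z| <= e).
  near (0:R)^'+ => d; exists d; near: d; [exact: nbhs_right_gt|exact: near0].
exists d => // x z x1 xz; have [t t01 tx] := cis_surj x1.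
by rewrite -tx; apply: dP; rewrite ?tx.
Unshelve. all: by end_near. Qed.

(** The mean value theorem for the primitive [G] gives [g c / n] on each cell, with [c] within
    [1 / n] of the node. *)
Lemma riemann_sum (g : R -> R) (e : R) n : (0 < n)%N -> continuous g ->
  (forall s t, `|s - t| <= n%:R^-1 -> `|g s - g t| <= e) ->
  `|\int[mu]_(t in `[0, 1]) g t - n%:R^-1 * \sum_(l < n) g (l%:R / n%:R)| <= e.
Proof.
move=> n0 cg ge.
have nR : 0 < n%:R :> R by rewrite ltr0n.
have gint (u : R) : mu.-integrable `[0, u] (EFin \o g).
  apply: continuous_compact_integrable; first exact: segment_compact.
  exact: continuous_subspaceT.
pose G := fun x => parameterized_integral mu 0 x g.
have G0 : G 0 = 0 by rewrite /G /parameterized_integral set_itv1 Rintegral_set1.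
have step l : (l < n)%N -> exists2 c, c \in `[l%:R / n%:R, l.+1%:R / n%:R] &
    G (l.+1%:R / n%:R) - G (l%:R / n%:R) = g c / n%:R.
  move=> ln.
  have le_l : l%:R / n%:R <= l.+1%:R / n%:R :> R.
    by rewrite ler_pM2r ?invr_gt0 // ler_nat.
  have hd (x : R) : x \in `](l%:R / n%:R), (l.+1%:R / n%:R)[ -> is_derive x (1:R) G (g x).
    rewrite in_itv /= => /andP[lx xl].
    have x0 : 0 < x by apply: le_lt_trans lx; rewrite divr_ge0.
    (* [G] is differentiated at [x] as an interior point of [[0, x + 1]]. *)
    have [dG GE] := @continuous_FTC1_closed R g 0 x (x + 1)
      (ltr_pwDr ltr01 (lexx x)) (gint _) x0 (cg x).
    by apply: (DeriveDef dG); rewrite -derive1E GE.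
  have hc : {within `[l%:R / n%:R, l.+1%:R / n%:R], continuous G}.
    have sub : `[l%:R / n%:R, l.+1%:R / n%:R]%classic `<=` `[(0:R), 1]%classic.
      move=> x /=; rewrite !in_itv /= => /andP[lx xl]; apply/andP; split.
        by apply: le_trans lx; rewrite divr_ge0.
      by apply: (le_trans xl); rewrite ler_pdivrMr // mul1r ler_nat.
    apply: (continuous_subspaceW sub).
    by apply: parameterized_integral_continuous; [exact: ler01|exact: gint].
  have [c cl cE] := MVT_segment le_l hd hc.
  exists c => //; rewrite cE -mulrBl -natrB // subSnn mul1r //.
have -> : \int[mu]_(t in `[0, 1]) g t =
    \sum_(l < n) (G (l.+1%:R / n%:R) - G (l%:R / n%:R)).
  rewrite -(big_mkord xpredT (fun l => G (l.+1%:R / n%:R) - G (l%:R / n%:R))).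
  rewrite telescope_sumr // divff ?gt_eqF // mul0r G0 subr0 //.
rewrite mulr_sumr -sumrB; apply: le_trans (ler_norm_sum _ _ _) _.
apply: (@le_trans _ _ (\sum_(l < n) e / n%:R)); last first.
  by rewrite sumr_const card_ord -(mulr_natl (e / _)) mulrC divfK // gt_eqF.
apply: ler_sum => l _; have [c + ->] := step l (ltn_ord l).
rewrite in_itv /= => /andP[lc cl].
rewrite [_^-1 * _]mulrC -mulrBl normrM [`|n%:R^-1|]ger0_norm ?invr_ge0 ?ler0n //.
rewrite ler_wpM2r ?invr_ge0 // ge // ger0_norm ?subr_ge0 //.
by rewrite lerBlDr (le_trans cl) // -natr1 mulrDl mul1r addrC.
Qed.
End circle_topology.

(** * Root sums compared with circle means *)

Section equidistribution.
Variable R : realType.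
Local Notation mu := (@lebesgue_measure R).
Local Notation cis := (@expi2pi R : R -> R[i]).

Definition circle_mean (f : R[i] -> R) : R := \int[mu]_(t in `[0, 1]) f (cis t).

Lemma continuous_cis_comp (f : R[i] -> R) :
  continuous f -> continuous (fun t : R => f (cis t)).
Proof.
move=> cf t; apply: (@continuous_comp _ _ _ cis f); last exact: cf.
exact: continuous_expi2pi.
Qed.

(** Continuity of [cis] at 0 gives its uniform continuity, as
    [cis s - cis t = cis s (1 - cis (t - s))]. The Fejer estimates call for at least [N] nodes. *)
Lemma riemann_circle (f : R[i] -> R) (e : R) (N : nat) : continuous f -> 0 < e ->
  exists2 n, (N <= n)%N &
   `|n%:R^-1 * \sum_(l < n) f (uroot R l) - circle_mean f| <= e.
Proof.
move=> cf e0.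
have [d d0 dP] := circle_uniform cf e0.
have : \forall h \near (0:R), normc (cis 0 - cis h) < d.
  exact: near_normc (@continuous_expi2pi R 0) d0.
move=> /nbhs_ballP[h /= h0 hP].
pose n := (maxn N (Num.bound h^-1)).+1.
exists n; first by rewrite ltnW // ltnS leq_maxl.
have n0 : 0 < n%:R :> R by rewrite ltr0n.
have nh : n%:R^-1 < h.
  rewrite -[h]invrK ltf_pV2 ?posrE ?invr_gt0 //.
  have /archi_boundP : 0 <= h^-1 by rewrite invr_ge0 ltW.
  by move=> /lt_le_trans; apply; rewrite ler_nat ltnW // ltnS leq_maxr.
rewrite distrC; apply: (@riemann_sum R (fun t : R => f (cis t))) => //.
  exact: continuous_cis_comp.
move=> s t st; apply: dP; first exact: normc_cis.
have -> : cis t = cis s * cis (t - s) by rewrite -cisD addrC subrK.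
rewrite -{1}[cis s]mulr1 -mulrBr normcM normc_cis mul1r -(cis0 R).
apply: hP; rewrite -ball_normE /= sub0r normrN distrC.
exact: le_lt_trans st nh.
Qed.

Lemma normc_unitc (z : R[i]) : z != 0 -> normc (unitc z) = 1.
Proof.
rewrite -normc_gt0 => z0.
by rewrite /unitc normcM normcV normc_real gtr0_norm // divff // gt_eqF.
Qed.

Lemma normc_unitc_sub (z : R[i]) : z != 0 -> normc (unitc z - z) = `|normc z - 1|.
Proof.
rewrite -normc_gt0 => z0; rewrite -normc_real rmorphB rmorph1.
have zC : (normc z)%:C%C != 0 by rewrite -normc_gt0 normc_real normr_gt0 gt_eqF.
transitivity (normc (unitc z * (1 - (normc z)%:C%C))).
  by rewrite mulrBr mulr1 divfK.
by rewrite normcM normc_unitc -?normc_gt0 // mul1r normcB.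
Qed.

(** [C] depends on [f] and [e] only. The path is: roots, their projections, kernel averages, Riemann
    sum, integral; four errors of [e / 4] per root arise. *)
Lemma root_sum_approx (f : R[i] -> R) (e : R) :
  continuous f -> bounded_fun f -> 0 < e ->
  exists C : R, forall (s : seq R[i]) (L : R),
    (forall w, normc w = 1 -> normc (\prod_(z <- s) (w - z)) <= L) ->
    0 \notin s ->
    `|\sum_(z <- s) f z - (size s)%:R * circle_mean f|
    <= (size s)%:R * e + C * root_height s L.
Proof.
move=> cf [M [_ /(_ (M + 1))]]; rewrite ltrDl ltr01 => /(_ isT) fM e0.
set B := M + 1 in fM.
have {}fM z : `|f z| <= B by apply: fM.
have B0 : 0 <= B by apply: le_trans (fM 0).
pose e' := e / 4; have e'0 : 0 < e' by rewrite divr_gt0.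
have [d d0 dP] := circle_uniform cf e'0.
have [N N1 Ne] : exists2 N, (0 < N)%N & 8 * B / (N%:R * d ^+ 2) <= e'.
  exists (Num.bound (8 * B / (d ^+ 2 * e'))).+1 => //.
  have de0 : 0 < d ^+ 2 * e' by rewrite mulr_gt0 ?exprn_gt0.
  have /archi_boundP : 0 <= 8 * B / (d ^+ 2 * e') by rewrite divr_ge0 ?mulr_ge0 // ltW.
  move: (Num.bound _) => m mB.
  have {mB} : 8 * B / (d ^+ 2 * e') <= m.+1%:R.
    by apply: ltW; apply: lt_le_trans mB _; rewrite ler_nat.
  rewrite !ler_pdivrMr ?mulr_gt0 ?exprn_gt0 ?ltr0n //; lra.
have [n Nn nI] := riemann_circle N cf e'0.
(* Chosen so that [|ln |z|| < d'] forces [||z| - 1| < d]. *)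
pose d' := ln (1 + d).
have d'0 : 0 < d' by rewrite ln_gt0 // ltrDl.
have d'd : d' <= d by apply: le_ln1Dx; lra.
(* Dominates the constant of the power sum bound for every [k < N]. *)
pose A : R := 2 * N%:R * 2 ^+ N + N%:R.
exists (2 * B / d' + B * (N%:R * A)) => s L sL s0.
set H := root_height s L.
have z_neq0 z : z \in s -> z != 0 by move=> zs; apply: contraNneq s0 => <-.
have H0 : 0 <= H := le_trans (ln_2L_ge0 sL) (ln_2L_le_height sL s0).
have f_unitc z : z \in s -> `|f z - f (unitc z)| <= e' + 2 * B / d' * `|ln (normc z)|.
  move=> /z_neq0 z0; have nz0 : 0 < normc z by rewrite normc_gt0.
  (* A root far from the circle is charged the crude bound [2 B] times [|ln |z|| / d' >= 1], whose
     sum the height controls. *)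
  have [far|close] := leP d' `|ln (normc z)|.
    apply: ler_wpDl; first exact: ltW.
    apply: (@le_trans _ _ (2 * B)).
      by apply: le_trans (ler_normB _ _) _; have := fM z; have := fM (unitc z); lra.
    by rewrite -mulrA ler_peMr ?mulr_ge0 // mulrC ler_pdivlMr // mul1r.
  apply: ler_wpDr; first by rewrite mulr_ge0 ?divr_ge0 ?mulr_ge0 // ltW.
  rewrite distrC; apply: dP; first exact: normc_unitc.
  rewrite normc_unitc_sub // -(lnK nz0).
  move: close; set x := ln _; rewrite ltr_norml => /andP[x1 x2].
  have : expR x < 1 + d by rewrite -ltr_ln ?posrE ?expR_gt0 ?expRK //; lra.
  have := expR_ge1Dx x; rewrite ltr_norml; lra.
have unit1 : {in map (@unitc R) s, forall x, normc x = 1}.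
  by move=> x /mapP[z /z_neq0 z0 ->]; exact: normc_unitc.
have A0 : 0 <= A by rewrite addr_ge0 ?mulr_ge0 ?exprn_ge0.
have unif x y : normc x = 1 -> normc y = 1 -> normc (x - y) < d -> `|f x - f y| <= e'.
  by move=> x1 _; exact: dP.
have Nn' : (0 < N <= n)%N by rewrite N1.
have power_le k : (0 < k < N)%N -> normc (\sum_(x <- map (@unitc R) s) x ^+ k) <= A * H.
  move=> /andP[k0 kN]; rewrite big_map.
  apply: le_trans (power_sum_unitc_le sL s0 k0) _; rewrite ler_wpM2r //.
  have kN' : k%:R <= N%:R :> R by rewrite ler_nat ltnW.
  rewrite lerD // ler_pM ?mulr_ge0 ?exprn_ge0 ?ler_pM2l //.
  by rewrite ler_weXn2l ?ler1n // ltnW.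
have sum_fejer := fejer_mean d0 fM unif Nn' (mulr_ge0 A0 H0) unit1 power_le.
rewrite size_map !big_map in sum_fejer.
have sum_unitc : `|\sum_(z <- s) f z - \sum_(z <- s) f (unitc z)| <=
    (size s)%:R * e' + 2 * B / d' * H.
  rewrite -sumrB; apply: le_trans (ler_norm_sum _ _ _) _.
  apply: (@le_trans _ _ (\sum_(z <- s) (e' + 2 * B / d' * `|ln (normc z)|))).
    by rewrite big_seq [leRHS]big_seq ler_sum.
  rewrite big_split /= -[X in _ + X]mulr_sumr big_const_seq count_predT iter_addr_0.
  rewrite -(mulr_natl e') lerD2l ler_wpM2l ?divr_ge0 ?mulr_ge0 ?(ltW d'0) //.
  exact: sum_abs_ln.
have nI' : `|(size s)%:R * (n%:R^-1 * \sum_(l < n) f (uroot R l)) -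
    (size s)%:R * circle_mean f| <= (size s)%:R * e'.
  by rewrite -mulrBr normrM normr_nat ler_wpM2l.
have Ns : (size s)%:R * (8 * B / (N%:R * d ^+ 2)) <= (size s)%:R * e'.
  by rewrite ler_wpM2l.
have eE : e = 4 * e' by rewrite /e'; lra.
apply: le_trans (ler_distD (\sum_(z <- s) f (unitc z)) _ _) _.
apply: le_trans (lerD sum_unitc (le_trans (ler_distD _ _ _) (lerD sum_fejer nI'))) _.
clearbody e' A H d' B; rewrite eE; move: Ns; move: (8 * B / _) => Q Ns; lra.
Qed.
End equidistribution.

(** * Equidistribution of roots *)

Section measures.
Variable R : realType.
Local Notation mu := (@lebesgue_measure R).
Local Notation cis := (@expi2pi R : R -> R[i]).

Lemma measurable_continuousC (f : R[i] -> R) : continuous f ->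
  measurable_fun [set: borelC R] (f : borelC R -> measurableTypeR R).
Proof.
move=> /continuousP cf; apply: (measurability _ (RGenOpens.measurableE R)) => //.
move=> _ [_ [a [b ->] <-]]; rewrite setTI.
apply: sub_sigma_algebra; apply: cf; exact: interval_open.
Qed.

Lemma size_croots (p : {poly R[i]}) : p != 0 -> size (croots p) = (size p).-1.
Proof.
rewrite /croots; case: closed_field_poly_normal => s /= pE p0.
by rewrite pE size_scale ?lead_coef_eq0 // size_prod_XsubC.
Qed.

Lemma ge0_integral_root_measure (f : R[i] -> R) (p : {poly R[i]}) :
  continuous f -> (forall z, 0 <= f z) -> p != 0 ->
  (\int[root_measure p]_z (f z)%:E =
   (((size p).-1%:R)^-1 * \sum_(z <- croots p) f z)%:E)%E.
Proof.
move=> cf f0 p0.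
have mf : measurable_fun [set: borelC R] (fun z => (f z)%:E).
  by apply/measurable_EFinP; exact: measurable_continuousC.
rewrite /root_measure ge0_integral_mscale //=; last by move=> z _; rewrite lee_fin.
rewrite ge0_integral_measure_sum //; last by move=> z _; rewrite lee_fin.
rewrite EFinM; congr (_ * _)%E.
rewrite (eq_bigr (fun j : 'I_(size p).-1 => (f (croots p)`_j)%:E)); last first.
  by move=> j _; rewrite integral_dirac // diracT mul1e.
by rewrite sumEFin (big_nth 0) big_mkord size_croots.
Qed.

Lemma ge0_integral_circle_haar (f : R[i] -> R) :
  continuous f -> (forall z, 0 <= f z) ->
  (\int[circle_haar R]_z (f z)%:E = (circle_mean f)%:E)%E.
Proof.
move=> cf f0.
have mf : measurable_fun [set: borelC R] (fun z => (f z)%:E).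
  by apply/measurable_EFinP; exact: measurable_continuousC.
rewrite ge0_integral_distribution //.
rewrite integral_uniform /=; last 2 first.
- by apply: measurableT_comp mf _; exact: measurable_expi2pi.
- by move=> ?; rewrite lee_fin.
rewrite subr0 invr1 mul1e /circle_mean /Rintegral fineK //.
apply: integrable_fin_num => //.
apply: continuous_compact_integrable; first exact: segment_compact.
by apply: continuous_subspaceT; exact: continuous_cis_comp.
Qed.

Lemma continuous_funrpos (f : R[i] -> R) : continuous f -> continuous f^\+.
Proof. by move=> cf x; apply: continuous_max; [exact: cf | exact: cst_continuous]. Qed.

Lemma continuous_funrneg (f : R[i] -> R) : continuous f -> continuous f^\-.
Proof.
move=> cf; rewrite -funrposN; apply: continuous_funrpos => x.
by apply: continuousN; exact: cf.
Qed.

(** The nonnegative case applies to the positive and negative parts, which are continuous and have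
    finite integrals. *)
Lemma integral_root_measure (f : R[i] -> R) (p : {poly R[i]}) :
  continuous f -> p != 0 ->
  (\int[root_measure p]_z (f z)%:E =
   (((size p).-1%:R)^-1 * \sum_(z <- croots p) f z)%:E)%E.
Proof.
move=> cf p0; rewrite integralE funerpos funerneg.
rewrite (ge0_integral_root_measure (continuous_funrpos cf) (funrpos_ge0 f) p0).
rewrite (ge0_integral_root_measure (continuous_funrneg cf) (funrneg_ge0 f) p0).
rewrite -EFinB -mulrBr -sumrB; congr (_ * _)%:E.
by apply: eq_bigr => z _; rewrite -[in RHS](funrposBneg f).
Qed.

Lemma integral_circle_haar (f : R[i] -> R) : continuous f ->
  (\int[circle_haar R]_z (f z)%:E = (circle_mean f)%:E)%E.
Proof.
move=> cf; rewrite integralE funerpos funerneg.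
rewrite (ge0_integral_circle_haar (continuous_funrpos cf) (funrpos_ge0 f)).
rewrite (ge0_integral_circle_haar (continuous_funrneg cf) (funrneg_ge0 f)).
have integrable_cis (g : R[i] -> R) : continuous g ->
    mu.-integrable `[0, 1] (EFin \o (g \o cis)).
  move=> cg; apply: continuous_compact_integrable; first exact: segment_compact.
  by apply: continuous_subspaceT; exact: continuous_cis_comp.
rewrite -EFinB -RintegralB //; [congr _%:E | | ].
- by apply: eq_Rintegral => t _; rewrite -[in RHS](funrposBneg f).
- exact: (integrable_cis f^\+) (continuous_funrpos cf).
- exact: (integrable_cis f^\-) (continuous_funrneg cf).
Qed.

Lemma horner_croots (p : {poly R[i]}) w :
  p.[w] = lead_coef p * \prod_(z <- croots p) (w - z).
Proof.
rewrite /croots; case: closed_field_poly_normal => s /= pE.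
rewrite {1}pE hornerZ horner_prod; congr (_ * _).
by apply: eq_bigr => z _; rewrite !hornerE.
Qed.

(** As [\prod |z| = |p(0)| / |lead_coef p|], one of the two terms [- ln |lead_coef p|] in the height
    cancels; the lower bounds on both extreme coefficients leave [D + 2 e1 d], an arbitrarily small
    multiple of the degree [d]. *)
Theorem equidistributed_of_subexponential (f_ : nat -> {poly R[i]}) (c : R) :
  0 < c ->
  (\forall n \near \oo, c <= normc (lead_coef (f_ n))) ->
  (\forall n \near \oo, c <= normc (f_ n).[0]) ->
  (forall K, \forall n \near \oo, (K <= (size (f_ n)).-1)%N) ->
  (forall e : R, 0 < e -> \forall n \near \oo,
     forall w, normc w = 1 -> normc (f_ n).[w] <= expR (e * (size (f_ n)).-1%:R)) ->
  equidistributed_on_circle f_.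
Proof.
move=> c0 lead_ge const_ge size_ge f_le g cg bg.
rewrite integral_circle_haar //.
apply: (@cvg_trans _ ((fun n =>
  (((size (f_ n)).-1%:R)^-1 * \sum_(z <- croots (f_ n)) g z)%:E) @ \oo)).
  apply: near_eq_cvg; near=> n.
  rewrite integral_root_measure //.
  rewrite -lead_coef_eq0 -normc_gt0; apply: lt_le_trans c0 _.
  by near: n.
apply: cvg_EFin; first by near=> n.
apply/cvgrPdist_le => e e0.
have e2 : 0 < e / 2 by rewrite divr_gt0.
have [C HC] := root_sum_approx cg bg e2.
pose C' := `|C| + 1; have C'0 : 0 < C' by rewrite ltr_wpDl.
(* Once [D <= e1 d], the height is at most [3 e1 d], and [C' * 3 e1 = 3 e / 8] fits below
   [e / 2]. *)
pose e1 := e / (8 * C').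
have e10 : 0 < e1 by rewrite divr_gt0 // mulr_gt0.
pose D := 2 * ln 2 - 2 * ln c.
near=> n.
have cl : c <= normc (lead_coef (f_ n)) by near: n.
have cc : c <= normc (f_ n).[0] by near: n.
have dD : ((Num.bound `|D / e1|).+1 <= (size (f_ n)).-1)%N by near: n.
have pw : forall w, normc w = 1 ->
    normc (f_ n).[w] <= expR (e1 * (size (f_ n)).-1%:R).
  by near: n; exact: f_le.
move: cl cc dD pw; set p := f_ n; set d := (size p).-1; set s := croots p.
rewrite -(ler_nat R) => cl cc dD pw.
have p0 : p != 0 by rewrite -lead_coef_eq0 -normc_gt0; apply: lt_le_trans cl.
have d0 : 0 < d%:R :> R by apply: lt_le_trans dD; rewrite ltr0n.
have a0 : 0 < normc (lead_coef p) by exact: lt_le_trans cl.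
pose L := expR (e1 * d%:R) / normc (lead_coef p).
have sL w : normc w = 1 -> normc (\prod_(z <- s) (w - z)) <= L.
  move=> /pw; rewrite horner_croots normcM /L -/s => pL.
  by rewrite ler_pdivlMr // mulrC.
have pc : normc p.[0] = normc (lead_coef p) * \prod_(z <- s) normc z.
  rewrite horner_croots normcM normc_prod -/s; congr (_ * _).
  by apply: eq_bigr => z _; rewrite sub0r normcN.
have s0 : 0 \notin s.
  apply/negP => s0; have : 0 < normc p.[0] by exact: lt_le_trans cc.
  have sz0 : \prod_(z <- s) z = 0.
    by apply/eqP; rewrite prodf_seq_eq0; apply/hasP; exists 0 => //=.
  by rewrite pc -normc_prod sz0 normc0 mulr0 ltxx.
have P0 : 0 < \prod_(z <- s) normc z.
  by have := lt_le_trans c0 cc; rewrite pc pmulr_rgt0.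
have height : root_height s L <= D + 2 * e1 * d%:R.
  have L0 : 0 < L by rewrite divr_gt0 ?expR_gt0.
  rewrite /root_height lnM ?posrE // /L lnM ?posrE ?expR_gt0 ?invr_gt0 //.
  rewrite lnV ?posrE // expRK.
  have : ln c <= ln (normc (lead_coef p)) by rewrite ler_ln.
  have : ln c <= ln (normc p.[0]) by rewrite ler_ln // posrE (lt_le_trans c0).
  rewrite pc lnM ?posrE // /D; lra.
have H0 : 0 <= root_height s L := le_trans (ln_2L_ge0 sL) (ln_2L_le_height sL s0).
have := HC s L sL s0; rewrite size_croots // -/d.
have -> : circle_mean g - d%:R^-1 * (\sum_(z <- s) g z) =
    - (d%:R^-1 * (\sum_(z <- s) g z - d%:R * circle_mean g)).
  by field; rewrite gt_eqF.
rewrite normrN normrM [`|d%:R^-1|]ger0_norm ?invr_ge0 ?ler0n // ler_pdivrMl //.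
move=> /le_trans; apply.
have De : D <= e1 * d%:R.
  rewrite mulrC -ler_pdivrMr //; apply: le_trans (ler_norm _) _.
  apply: le_trans _ dD; apply: ltW.
  apply: (@lt_le_trans _ _ (Num.bound `|D / e1|)%:R); last by rewrite ler_nat.
  exact: archi_boundP.
have CH : C * root_height s L <= C' * (3 * e1 * d%:R).
  apply: (@le_trans _ _ (C' * root_height s L)).
    by rewrite ler_wpM2r // /C' (le_trans (ler_norm _)) // lerDl.
  by rewrite ler_pM2l //; lra.
have : C' * (3 * e1 * d%:R) <= e / 2 * d%:R.
  rewrite mulrA ler_pM2r // /e1.
  have -> : C' * (3 * (e / (8 * C'))) = 3 / 8 * e.
    by field; rewrite gt_eqF.
  lra.
lra.
Unshelve. all: by end_near.
Qed.

End measures.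

(** * Number of partitions *)

Lemma sumn_count n (s : seq nat) : 0%N \notin s -> {in s, forall i, (i <= n)%N} ->
  sumn s = (\sum_(i < n) i.+1 * count_mem i.+1 s)%N.
Proof.
elim: s => [|x s IH] s0 sn; first by rewrite big1 // => i _; rewrite muln0.
move: s0; rewrite inE negb_or; case: x sn => // x sn /andP[_ s0].
rewrite [LHS]/= IH // => [|i si]; last by apply: sn; rewrite inE si orbT.
have xn : (x < n)%N by apply: sn; rewrite mem_head.
rewrite (eq_bigr (fun i : 'I_n => i.+1 * (x.+1 == i.+1) + i.+1 * count_mem i.+1 s)%N
  (fun i _ => mulnDr _ _ _)).
rewrite [RHS]big_split; congr (_ + _)%N.
rewrite (bigD1 (Ordinal xn)) // eqxx muln1 big1 => [/=|i ix]; first by rewrite addn0.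
by rewrite eqSS eq_sym; move: ix; rewrite -val_eqE => /negPf /= ->; rewrite muln0.
Qed.

(** Index [i] stands for the part [i + 1]. Counts never exceed [n], so [inord] does not truncate;
    finite functions index the expansion of Euler's product. *)
Definition multiplicities n (p : intpart n) : {ffun 'I_n -> 'I_n.+1} :=
  [ffun i : 'I_n => inord (count_mem i.+1 (parts p))].

Lemma multiplicitiesE n (p : intpart n) i :
  multiplicities p i = count_mem i.+1 (parts p) :> nat.
Proof.
rewrite ffunE inordK // ltnS; apply: leq_trans (count_size _ _) _.
by case: (intpart_bounded p).
Qed.

Lemma multiplicities_inj n : injective (@multiplicities n).
Proof.
move=> p q pq; apply: val_inj => /=.
have [_ pn] := intpart_bounded p; have [_ qn] := intpart_bounded q.
have /and3P[sp p0 _] := intpartP p; have /and3P[sq q0 _] := intpartP q.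
have geq_trans : transitive geq by move=> x y z /= xy yz; apply: leq_trans yz xy.
apply: (sorted_eq geq_trans) => //.
  by move=> x y /andP[xy yx]; apply: anti_leq; apply/andP.
apply/allP => -[|v] _ /=; first by rewrite !(count_memPn _).
have [vn|nv] := ltnP v n.
  by rewrite -(multiplicitiesE p (Ordinal vn)) pq multiplicitiesE.
have big_notin (s : seq nat) : {in s, forall i, (i <= n)%N} -> v.+1 \notin s.
  by move=> sn; apply/negP => /sn; rewrite ltnNge nv.
by rewrite !(count_memPn _) //; exact: big_notin.
Qed.

Lemma multiplicities_sum n (p : intpart n) :
  (\sum_(i < n) i.+1 * multiplicities p i)%N = n.
Proof.
have [_ pn] := intpart_bounded p; have /and3P[_ p0 /eqP pE] := intpartP p.
by under eq_bigr do rewrite multiplicitiesE; rewrite -sumn_count.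
Qed.

Lemma sum_geometric_le (R : realType) (x : R) n : 0 < x < 1 ->
  \sum_(m < n) x ^+ m <= (1 - x)^-1.
Proof.
move=> /andP[x0 x1]; rewrite -[leRHS]mul1r ler_pdivlMr ?subr_gt0 //.
have := subrX1 x n; have : 0 <= x ^+ n by rewrite exprn_ge0 // ltW.
by move: (x ^+ n) (\sum_(m < n) _) => a b; lra.
Qed.

(* Euler's product: [\sum_n p(n) x^n = \prod_j 1 / (1 - x^j)]. *)
Lemma card_intpart_le (R : realType) (x : R) n : 0 < x < 1 ->
  #|{: intpart n}|%:R * x ^+ n <= expR (x / (1 - x) ^+ 2).
Proof.
move=> x01; have /andP[x0 x1] := x01.
pose F (g : {ffun 'I_n -> 'I_n.+1}) : R := \prod_(i < n) (x ^+ i.+1) ^+ g i.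
have F0 g : 0 <= F g.
  by apply: prodr_ge0 => i _; rewrite !exprn_ge0 // ltW.
have FE p : F (multiplicities p) = x ^+ n.
  rewrite -[in RHS](multiplicities_sum p) expr_sum.
  by apply: eq_bigr => i _; rewrite exprM.
have -> : #|{: intpart n}|%:R * x ^+ n = \sum_(p : intpart n) F (multiplicities p).
  under eq_bigr do rewrite FE; rewrite sumr_const mulr_natl; congr (_ *+ _).
(* Enlarging the sum to all multiplicity functions lets it factor into truncated geometric series,
   one per part size. *)
apply: (@le_trans _ _ (\sum_g F g)).
  rewrite -(big_imset F (h := @multiplicities n)) /=; last first.
    by move=> p q _ _; exact: multiplicities_inj.
  rewrite big_mkcond ler_sum // => g _; by case: ifP.
rewrite -(bigA_distr_bigA (fun (i : 'I_n) (m : 'I_n.+1) => (x ^+ i.+1) ^+ m)) /=.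
have x10 : 0 < 1 - x by rewrite subr_gt0.
apply: (@le_trans _ _ (\prod_(i < n) expR (x ^+ i.+1 / (1 - x)))).
  apply: ler_prod => i _; apply/andP; split.
    by apply: sumr_ge0 => m _; rewrite !exprn_ge0 // ltW.
  have y0 : 0 < x ^+ i.+1 by rewrite exprn_gt0.
  have yx : x ^+ i.+1 <= x by rewrite exprS ger_pMr // exprn_ile1 // ltW.
  apply: le_trans (sum_geometric_le _ _) _.
    by rewrite y0 /=; apply: le_lt_trans yx x1.
  apply: le_trans (expR_ge1Dx _).
  have y10 : 0 < 1 - x ^+ i.+1 by rewrite subr_gt0 (le_lt_trans yx).
  (* With [y = x ^+ i.+1 <= x]: [1 / (1 - y) = 1 + y / (1 - y) <= 1 + y / (1 - x)]. *)
  apply: (@le_trans _ _ (1 + x ^+ i.+1 / (1 - x ^+ i.+1))).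
    by rewrite le_eqVlt; apply/orP; left; apply/eqP; field; rewrite gt_eqF.
  by rewrite lerD2l ler_pM2l // lef_pV2 ?posrE //; lra.
rewrite -expR_sum ler_expR -mulr_suml.
under eq_bigr do rewrite exprS.
rewrite -mulr_sumr expr2 invfM mulrA ler_pM2r ?invr_gt0 // ler_pM2l //.
exact: sum_geometric_le.
Qed.

(** With [x = exp (- e / 2)], dividing by [x ^+ n] costs [exp (e n / 2)]; for large [n] the other
    half of the exponent absorbs the constant [D]. *)
Lemma card_intpart_subexponential (R : realType) (e : R) : 0 < e ->
  \forall n \near \oo, #|{: intpart n}|%:R <= expR (e * n%:R).
Proof.
move=> e0; pose x := expR (- (e / 2)).
have x01 : 0 < x < 1 by rewrite expR_gt0 -expR0 ltr_expR; lra.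
pose D := x / (1 - x) ^+ 2.
near=> n.
have Dn : (Num.bound `|D / (e / 2)|)%:R <= n%:R :> R.
  by rewrite ler_nat; near: n; exact: nbhs_infty_ge.
have := card_intpart_le n x01; rewrite -/D -ler_pdivlMr ?exprn_gt0 ?expR_gt0 //.
move=> /le_trans; apply.
rewrite -expRM_natl -expRN -expRD ler_expR.
have /ltW /le_trans /(_ Dn) :
    `|D / (e / 2)| < (Num.bound `|D / (e / 2)|)%:R by exact: archi_boundP.
move=> /(le_trans (ler_norm _)); rewrite ler_pdivrMr ?divr_gt0 //; lra.
Unshelve. all: by end_near. Qed.

(** * Rank and crank polynomials *)

Section stat_poly.
Variable R : realType.

(** Common form of both polynomials, with [K = n] for the rank and [K = n + 1] for the crank; the
    degree is [K - 1] when the top coefficient is nonzero. *)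
Definition stat_poly (N : nat -> nat) (K : nat) : {poly R[i]} :=
  ((N 0%N)%:R / 2)%:P + \sum_(1 <= m < K) (N m)%:R *: 'X^m.

Lemma normc_nat n : normc (n%:R : R[i]) = n%:R.
Proof. by rewrite -(rmorph_nat (real_complex R)) normc_real normr_nat. Qed.

Lemma stat_polyE N K : (0 < K)%N ->
  stat_poly N K = \poly_(m < K) (if m == 0%N then (N 0%N)%:R / 2 else (N m)%:R).
Proof.
case: K => // K _; rewrite poly_def big_ord_recl /= expr0 alg_polyC; congr (_ + _).
by rewrite big_add1 /= big_mkord.
Qed.

Lemma normc_stat_poly_le N K w : (0 < K)%N -> normc w = 1 ->
  normc (stat_poly N K).[w] <= (\sum_(m < K) N m)%:R.
Proof.
move=> K0 w1; rewrite stat_polyE // horner_poly natr_sum.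
apply: le_trans (ler_normc_sum _ _ _) _; apply: ler_sum => m _.
rewrite normcM normcX w1 expr1n mulr1; case: eqP => [->|_]; last by rewrite normc_nat.
by rewrite normc_half normc_nat ler_piMr // invf_le1 ?ler1n.
Qed.

Lemma size_stat_poly N K : (1 < K)%N -> (0 < N K.-1)%N -> size (stat_poly N K) = K.
Proof.
case: K => [|[|K]] // _ NK; rewrite stat_polyE // size_poly_eq //=.
by rewrite pnatr_eq0 -lt0n.
Qed.

Lemma lead_coef_stat_poly N K : (1 < K)%N -> (0 < N K.-1)%N ->
  lead_coef (stat_poly N K) = (N K.-1)%:R.
Proof.
move=> K1 NK; rewrite lead_coefE size_stat_poly // stat_polyE ?(ltnW K1) //.
by rewrite coef_poly; case: K K1 {NK} => [|[|K]] //= _; rewrite ltnSn.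
Qed.

Lemma stat_poly0 N K : (0 < K)%N -> (stat_poly N K).[0] = (N 0%N)%:R / 2.
Proof. by move=> K0; rewrite stat_polyE // horner_coef0 coef_poly K0. Qed.

Definition num_stat (st : seq nat -> int) (n m : nat) : nat :=
  #|[set p : intpart n | st p == m%:Z]%SET|.

Lemma sum_num_stat_le st n K :
  (\sum_(m < K) num_stat st n m <= #|{: intpart n}|)%N.
Proof.
rewrite -sum1_card (eq_bigr (fun m : 'I_K => \sum_(p : intpart n) (st p == m%:Z))%N).
  rewrite exchange_big leq_sum // => p _ /=.
  have [/existsP[m /eqP ->]|/existsPn H] := boolP [exists m : 'I_K, st p == m%:Z].
    rewrite (bigD1 m) //= eqxx big1 // => j jm.
    by rewrite eqz_nat eq_sym; move: jm; rewrite -val_eqE => /negPf /= ->.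
  by rewrite big1 // => m _; rewrite (negPf (H m)).
move=> m _; rewrite /num_stat -sum1_card big_mkcond; apply: eq_bigr => p _.
by rewrite inE; case: (_ == _).
Qed.

Lemma num_stat_gt0 st n m s : is_intpart n s -> st s = m%:Z ->
  (0 < num_stat st n m)%N.
Proof.
move=> sn sm; apply/card_gt0P; exists (IntPart sn).
by rewrite inE /= sm.
Qed.

(** Reduces each case to exhibiting one partition for the constant and one for the leading
    coefficient; a positive integer, even halved, is at least [1/2]. *)
Lemma stat_poly_equidistributed (st : seq nat -> int) (K : nat -> nat) :
  (forall n, (n <= K n)%N) ->
  (\forall n \near \oo, (0 < num_stat st n 0)%N) ->
  (\forall n \near \oo, (0 < num_stat st n (K n).-1)%N) ->
  equidistributed_on_circle (fun n => stat_poly (num_stat st n) (K n)).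
Proof.
move=> Kn const_gt0 lead_gt0.
have K2 : \forall n \near \oo, (1 < K n)%N.
  by near=> n; apply: leq_trans (Kn n); near: n; exact: nbhs_infty_ge.
have half_le k : (0 < k)%N -> 2^-1 <= k%:R :> R.
  by rewrite -(ler_nat R); lra.
apply: (@equidistributed_of_subexponential _ _ 2^-1); first by rewrite invr_gt0.
- near=> n; have K2n : (1 < K n)%N by near: n.
  have gt0 : (0 < num_stat st n (K n).-1)%N by near: n.
  by rewrite lead_coef_stat_poly // normc_nat half_le.
- near=> n; have K2n : (1 < K n)%N by near: n.
  have gt0 : (0 < num_stat st n 0)%N by near: n.
  by rewrite stat_poly0 ?(ltnW K2n) // normc_half normc_nat ler_peMl ?invr_ge0 // ler1n.
- move=> k; near=> n; have K2n : (1 < K n)%N by near: n.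
  have gt0 : (0 < num_stat st n (K n).-1)%N by near: n.
  rewrite size_stat_poly // -ltnS prednK ?(ltnW K2n) //.
  by apply: leq_trans (Kn n); near: n; exact: nbhs_infty_ge.
- move=> e e0; have e2 : 0 < e / 2 by rewrite divr_gt0.
  near=> n => w w1; have K2n : (1 < K n)%N by near: n.
  have gt0 : (0 < num_stat st n (K n).-1)%N by near: n.
  apply: le_trans (normc_stat_poly_le _ (ltnW K2n) w1) _.
  apply: (@le_trans _ _ #|{: intpart n}|%:R); first by rewrite ler_nat sum_num_stat_le.
  (* The exponent is halved because the degree is [K n - 1], and [n <= K n <= 2 (K n - 1)] once
     [K n >= 2]. *)
  apply: (@le_trans _ _ (expR (e / 2 * n%:R))).
    by move: w1 => _; near: n; exact: card_intpart_subexponential.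
  rewrite ler_expR size_stat_poly // -mulrA ler_pM2l // ler_pdivrMl //.
  rewrite -natrM ler_nat; apply: leq_trans (Kn n) _.
  by case: (K n) K2n => [|[|k]] //= _; rewrite mul2n -addnn addSn ltnS leq_addl.
Unshelve. all: by end_near. Qed.
End stat_poly.

(** * Explicit partitions for the extreme coefficients *)

Lemma is_intpart_cons x s : (0 < x)%N -> all (leq^~ x) s ->
  sorted geq s -> 0%N \notin s -> is_intpart (x + sumn s) (x :: s).
Proof.
move=> x0 sx ss s0; rewrite /is_intpart /= eqxx andbT inE negb_or neq_ltn x0 s0 /= andbT.
by rewrite path_sortedE ?sx // => a b c /= ab bc; apply: leq_trans bc ab.
Qed.

Lemma largest_part_cons x s : all (leq^~ x) s -> largest_part (x :: s) = x.
Proof.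
move=> /allP sx; rewrite /largest_part big_cons; apply/maxn_idPl.
by apply/bigmax_leqP_seq => i /sx.
Qed.

Lemma sorted_nseq_geq k x : sorted geq (nseq k x).
Proof. by case: k => //= k; elim: k => //= k ->; rewrite andbT leqnn. Qed.

(** Witnesses: [k + 1] followed by [k] ones for [n = 2k + 1]; [k], [2] and [k - 2] ones for
    [n = 2k]. *)
Lemma num_rank_gt0 n : (2 < n)%N -> (0 < num_stat part_rank n 0)%N.
Proof.
move=> n2; have oneS k x : (0 < x)%N -> all (leq^~ x) (nseq k 1%N).
  by move=> x0; rewrite all_nseq x0 orbT.
have one0 k : 0%N \notin nseq k 1%N by rewrite mem_nseq andbF.
have sorted1 := sorted_nseq_geq.
have n1 : (0 < n./2)%N by case: n n2 => [|[|[]]].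
have halfE := odd_double_half n.
have [n_odd|n_even] := boolP (odd n); rewrite ?n_odd ?(negPf n_even) /= in halfE.
  have s_le := oneS n./2 n./2.+1 isT.
  apply: (@num_stat_gt0 _ _ _ (n./2.+1 :: nseq n./2 1%N)).
    have := is_intpart_cons (ltn0Sn _) s_le (sorted1 _ _) (one0 _).
    by rewrite sumn_nseq mul1n addSn addnn -add1n halfE.
  by rewrite /part_rank largest_part_cons //= size_nseq subrr.
rewrite add0n in halfE.
have k2 : (1 < n./2)%N by rewrite -ltn_double halfE.
have kE : (n./2.-2.+2 = n./2)%N by case: (n./2) k2 => [|[]].
have s_le : all (leq^~ n./2) (2 :: nseq n./2.-2 1)%N by rewrite /= k2 oneS.
have s_sorted : sorted geq (2 :: nseq n./2.-2 1)%N.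
  by rewrite /= path_sortedE ?oneS ?sorted1 // => a b c /= ab bc; apply: leq_trans bc ab.
apply: (@num_stat_gt0 _ _ _ (n./2 :: 2 :: nseq n./2.-2 1)%N).
  have := is_intpart_cons n1 s_le s_sorted; rewrite inE /= => /(_ (one0 _)).
  rewrite sumn_nseq mul1n -[(2 + _)%N]/(n./2.-2.+2)%N.
  by rewrite kE addnn halfE.
rewrite /part_rank largest_part_cons //= size_nseq.
by rewrite kE subrr.
Qed.

(** The partition [(n - 1, 1)] has a single 1 and a single part larger than 1. *)
Lemma num_crank_gt0 n : (2 < n)%N -> (0 < num_stat part_crank n 0)%N.
Proof.
case: n => [|[|[|n]]] // _.
apply: (@num_stat_gt0 _ _ _ [:: n.+2; 1%N]) => //.
by have := @is_intpart_cons n.+2 [:: 1%N] isT isT isT isT; rewrite /= addn0 addn1.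
Qed.

Theorem theorem4p2 (R : realType) :
  equidistributed_on_circle (rank_poly R) /\
  equidistributed_on_circle (crank_poly R).
Proof.
split.
- apply: (@stat_poly_equidistributed R part_rank id) => //.
  + by near=> n; apply: num_rank_gt0; near: n; exact: nbhs_infty_gt.
  (* The one-part partition has rank [n - 1], the top exponent. *)
  + near=> n; have n0 : (0 < n)%N by near: n; exact: nbhs_infty_gt.
    apply: (@num_stat_gt0 _ _ _ [:: n]).
      by have := @is_intpart_cons n [::] n0 isT isT isT; rewrite addn0.
    by rewrite /part_rank largest_part_cons //= subzn // subn1.
- apply: (@stat_poly_equidistributed R part_crank succn) => //.
  + by near=> n; apply: num_crank_gt0; near: n; exact: nbhs_infty_gt.
  (* For [n > 1] the one-part partition has no part 1, so its crank is its largest part [n]. *)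
  + near=> n; have n1 : (1 < n)%N by near: n; exact: nbhs_infty_gt.
    apply: (@num_stat_gt0 _ _ _ [:: n]).
      by have := @is_intpart_cons n [::] (ltnW n1) isT isT isT; rewrite addn0.
    by rewrite /part_crank inE ltn_eqF //= largest_part_cons.
Unshelve. all: by end_near.
Qed.
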